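(* Let $\mathbb{F}$ be any field, $G$ a group, and $\mathcal{G}: A_G=\bigoplus_{g\in G}A_g$ a $G$-graded $\mathbb{F}$-algebra. Then there is a well-defined map (the obstruction map described in the context) $$\omega_{\mathcal{G}}:\mathrm{Irr}_{\mathbb{F}}(A_e)^{\mathcal{G}}\to H^2(G,\mathbb{F}^* )$$ such that for every $[M]\in \mathrm{Irr}_{\mathbb{F}}(A_e)^{\mathcal{G}}$ and every $\alpha\in Z^2(G,\mathbb{F}^* )$: if $\alpha^{-1}$ belongs to the cohomology class $\omega_{\mathcal{G}}([M])$, then $M$ is restricted from the twisted graded algebra $\alpha(A_G)$; and if moreover $A_G$ is strongly graded, the converse holds, i.e. $M$ is restricted from $\alpha(A_G)$ if and only if $\alpha^{-1}\in\omega_{\mathcal{G}}([M])$. In particular, $M$ is restricted from $A_G$ if (and, when $A_G$ is strongly graded, only if) $\omega_{\mathcal{G}}([M])=1$.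
   Context: Algebras are associative and unital; modules are left modules; $e$ is the identity of $G$. A $G$-graded $\mathbb{F}$-algebra is an $\mathbb{F}$-algebra with a vector space decomposition $A_G=\bigoplus_{g\in G}A_g$ with $A_gA_h\subseteq A_{gh}$ for all $g,h$; it is strongly graded if $A_gA_h=A_{gh}$ for all $g,h$; $A_e$ is its base algebra. A $G$-graded left $A_G$-module is $W_G=\bigoplus_{g}W_g$ with $A_gW_h\subseteq W_{gh}$. Graded homomorphisms of $G$-graded algebras or modules are degree-preserving homomorphisms; $\stackrel{G}{\cong}$ denotes graded isomorphism. $Z^2(G,\mathbb{F}^* )$, $H^2(G,\mathbb{F}^* )$ are taken with trivial $G$-action on $\mathbb{F}^*$. For $\alpha\in Z^2(G,\mathbb{F}^* )$, $\mathbb{F}^{\alpha}G=\bigoplus_{g}\mathbb{F}v_g$, $v_gv_h=\alpha(g,h)v_{gh}$, is the $G$-graded twisted group algebra. The graded product of $G$-graded spaces is $A_G\otimes^G_{\mathbb{F}}A'_G=\bigoplus_{g}A_g\otimes_{\mathbb{F}}A'_g\subseteq A_G\otimes_{\mathbb{F}}A'_G$, and $\alpha(A_G):=\mathbb{F}^{\alpha}G\otimes^G_{\mathbb{F}}A_G$. The base algebra of $\alpha(A_G)$ is identified with $A_e$ via $x\mapsto 1\otimes x$. An $A_e$-module $M$ is restricted from $\alpha(A_G)$ if it is the restriction to $A_e$ of some $\alpha(A_G)$-module. An $A_e$-module $M$ is $\mathbb{F}$-absolutely simple if it is simple and $\mathrm{End}_{A_e}(M)=\mathbb{F}\cdot\mathrm{Id}_M$;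 $\mathrm{Irr}_{\mathbb{F}}(A_e)$ is the set of isomorphism classes of such modules. For an $A_e$-module $M$, the module $A_G\otimes_{A_e}M$ is graded by $(A_G\otimes_{A_e}M)_g=A_g\otimes_{A_e}M$, and the associated graded module is $A_G\overline{\otimes}_{A_e}M:=(A_G\otimes_{A_e}M)/t$, where $t$ is the largest graded submodule with zero $e$-component. The suspension $h(W_G)$ of a graded module is the same module regraded by $h(W_G)_g:=W_{gh}$. $M$ is $\mathcal{G}$-invariant if $A_G\overline{\otimes}_{A_e}M\stackrel{G}{\cong}g(A_G\overline{\otimes}_{A_e}M)$ as graded $A_G$-modules for all $g\in G$; $\mathrm{Irr}_{\mathbb{F}}(A_e)^{\mathcal{G}}\subseteq\mathrm{Irr}_{\mathbb{F}}(A_e)$ is the subset of $\mathcal{G}$-invariant classes. $\mathrm{End}^{\mathrm{r}(G)}_{A_G}(W_G)=\bigoplus_{h\in G}\mathrm{End}^{\mathrm{r}(h)}_{A_G}(W_G)$, where $\mathrm{End}^{\mathrm{r}(h)}_{A_G}(W_G)$ consists of the $A_G$-endomorphisms $\varphi$ with $\varphi(W_g)\subseteq W_{gh}$ for all $g$; it acts on $W_G$ from the right (the product $\varphi\psi$ means first $\varphi$, then $\psi$) and is a $G$-graded algebra. The obstruction map: $\omega_{\mathcal{G}}([M])$ is the unique class $[\omega]\in H^2(G,\mathbb{F}^* )$ with $\mathrm{End}^{\mathrm{r}(G)}_{A_G}(A_G\overline{\otimes}_{A_e}M)\stackrel{G}{\cong}\mathbb{F}^{\omega}G$. *)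

(* Defs.v *)
From HB Require Import structures.
From mathcomp Require Import all_boot all_algebra.
From mathcomp Require Import boolp functions.
From mathcomp Require Import finmap monalg.

Set Implicit Arguments.
Unset Strict Implicit.
Unset Printing Implicit Defensive.

Import GRing.Theory.
Local Open Scope ring_scope.
Local Open Scope quotient_scope.

Section DirectDecomposition.
Variables (I : choiceType) (V : zmodType).

Definition in_sum (C : I -> {pred V}) (v : V) : Prop :=
  exists (s : seq I) (f : I -> V),
    [/\ uniq s, forall i, f i \in C i & v = \sum_(i <- s) f i].

(* V is the internal direct sum of the subgroups C i; I may be infinite, and all
   sums run over a finite repetition-free list of indices. *)
Definition direct_decomposition (C : I -> {pred V}) : Prop :=
  (forall v, in_sum C v) /\
  (forall (s : seq I) (f : I -> V), uniq s -> (forall i, f i \in C i) ->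
     \sum_(i <- s) f i = 0 -> {in s, forall i, f i = 0}).

Variable C : I -> {pred V}.
Hypothesis Cz : forall i, zmod_closed (C i).

Definition is_decomp (v : V) (f : I -> V) := (forall i, f i \in C i) /\
  exists s, [/\ uniq s, forall i, i \notin s -> f i = 0 & v = \sum_(i <- s) f i].

Lemma sum_pick (s : seq I) (f : I -> V) i :
  uniq s -> (forall i, i \notin s -> f i = 0) ->
  \sum_(j <- s) (if j == i then f j else 0) = f i.
Proof.
move=> us f0; case: (boolP (i \in s)) => si.
  by rewrite -big_mkcond -big_filter filter_pred1_uniq // big_seq1.
rewrite (f0 _ si) big1_seq // => j /andP[_ sj]; case: eqP => // ji.
by rewrite -ji sj in si.
Qed.

Lemma sum_extend (s t : seq I) (f : I -> V) :
  uniq s -> uniq t -> {subset s <= t} -> (forall i, i \notin s -> f i = 0) ->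
  \sum_(i <- s) f i = \sum_(i <- t) f i.
Proof.
move=> us ut st f0.
rewrite [RHS](bigID (mem s)) /= [X in _ + X]big1 ?addr0; last by move=> i /f0.
rewrite -[RHS]big_filter; apply: perm_big; apply: uniq_perm => //.
  exact: filter_uniq.
by move=> i; rewrite mem_filter; case: (boolP (i \in s)) => //= /st ->.
Qed.

Lemma in_sum_decomp v : in_sum C v <-> exists f, is_decomp v f.
Proof.
split=> [[s [f [us fC ->]]]|[f [fC [s [us _ ->]]]]]; last by exists s, f.
exists (fun i => if i \in s then f i else 0); split.
  by move=> i; case: ifP => // _; case: (Cz i).
exists s; split => // [i /negbTE -> //|].
by apply: eq_big_seq => i ->.
Qed.

Lemma decompB v w f f' : is_decomp v f -> is_decomp w f' ->
  is_decomp (v - w) (fun i => f i - f' i).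
Proof.
move=> [fC [s [us f0 ->]]] [fC' [s' [us' f0' ->]]]; split.
  by move=> i; case: (Cz i) => _; apply.
exists (undup (s ++ s')); split; first exact: undup_uniq.
  move=> i; rewrite mem_undup mem_cat negb_or => /andP[/f0 -> /f0' ->].
  exact: subrr.
rewrite sumrB; congr (_ - _); apply: sum_extend => //; try exact: undup_uniq.
- by move=> i si; rewrite mem_undup mem_cat si.
- by move=> i si; rewrite mem_undup mem_cat si orbT.
Qed.

Lemma in_sum0 : in_sum C 0.
Proof.
by exists [::], (fun=> 0); rewrite big_nil; split=> // i; case: (Cz i).
Qed.

Lemma in_sumB v w : in_sum C v -> in_sum C w -> in_sum C (v - w).
Proof.
move=> /in_sum_decomp[f vf] /in_sum_decomp[f' wf'].
by apply/in_sum_decomp; exists (fun i => f i - f' i); apply: decompB.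
Qed.

Lemma in_sumD v w : in_sum C v -> in_sum C w -> in_sum C (v + w).
Proof.
move=> vC wC; rewrite -[w]opprK; apply: in_sumB => //.
by rewrite -sub0r; apply: in_sumB => //; apply: in_sum0.
Qed.

Lemma in_sum_sum (J : Type) (r : seq J) (P : pred J) (g : J -> V) :
  (forall j, P j -> in_sum C (g j)) -> in_sum C (\sum_(j <- r | P j) g j).
Proof. by move=> gC; apply: big_ind => //; [apply: in_sum0 | apply: in_sumD]. Qed.

Lemma in_sum_comp i v : v \in C i -> in_sum C v.
Proof.
move=> vC; exists [:: i], (fun j => if i == j then v else 0); split=> // [j|].
  by case: eqP => [<- //|_]; case: (Cz j).
by rewrite big_seq1 eqxx.
Qed.

Hypothesis Cd : direct_decomposition C.

Lemma decomp_ex v : exists f, is_decomp v f.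
Proof. by apply/in_sum_decomp; case: Cd. Qed.

Lemma decomp0 f : is_decomp 0 f -> forall i, f i = 0.
Proof.
move=> [fC [s [us f0 /esym sf]]] i; case: (boolP (i \in s)) => [|/f0 //].
exact: (Cd.2 _ _ us fC sf).
Qed.

Definition dproj (i : I) (v : V) : V := sval (cid (decomp_ex v)) i.

Lemma dprojP v : is_decomp v (dproj^~ v).
Proof. exact: (svalP (cid (decomp_ex v))). Qed.

Lemma dproj_eq v f i : is_decomp v f -> dproj i v = f i.
Proof.
move=> vf; have := decompB (dprojP v) vf; rewrite subrr => /decomp0/(_ i)/eqP.
by rewrite subr_eq0 => /eqP.
Qed.

Lemma dproj_mem i v : dproj i v \in C i.
Proof. by case: (dprojP v). Qed.

Lemma dproj_sum v : exists s, [/\ uniq s, forall i, i \notin s -> dproj i v = 0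
  & v = \sum_(i <- s) dproj i v].
Proof. by case: (dprojP v). Qed.

Fact dproj_is_additive i : zmod_morphism (dproj i).
Proof. by move=> v w; rewrite (dproj_eq _ (decompB (dprojP v) (dprojP w))). Qed.

HB.instance Definition _ i := GRing.isZmodMorphism.Build V V (dproj i)
  (dproj_is_additive i).

Lemma dproj_id i j v : v \in C i -> dproj j v = if i == j then v else 0.
Proof.
move=> vC; apply: (@dproj_eq _ (fun j => if i == j then v else 0)); split.
  by move=> k; case: eqP => [<- //|_]; case: (Cz k).
exists [:: i]; split => // [k|]; last by rewrite big_seq1 eqxx.
by rewrite inE eq_sym => /negbTE ->.
Qed.
End DirectDecomposition.

Section DprojMorph.
Variables (I I' : choiceType) (V V' : zmodType).
Variables (C : I -> {pred V}) (C' : I' -> {pred V'}).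
Hypotheses (Cz : forall i, zmod_closed (C i)) (Cd : direct_decomposition C).
Hypotheses (Cz' : forall i, zmod_closed (C' i)) (Cd' : direct_decomposition C').
Variables (sigma : I -> I') (phi : {additive V -> V'}).
Hypothesis sigmaI : injective sigma.
Hypothesis phiC : forall i v, v \in C i -> phi v \in C' (sigma i).

Lemma dproj_morph i v :
  dproj Cz' Cd' (sigma i) (phi v) = phi (dproj Cz Cd i v).
Proof.
have [s [us s0 {1}->]] := dproj_sum Cz Cd v.
rewrite !raddf_sum /=.
transitivity (\sum_(j <- s) (if j == i then phi (dproj Cz Cd j v) else 0)).
  apply: eq_bigr => j _; rewrite (dproj_id Cz' Cd' _ (phiC (dproj_mem _ _ j v))).
  by rewrite (inj_eq sigmaI).
by rewrite (@sum_pick _ _ s (fun j => phi (dproj Cz Cd j v))) // => j /s0 ->; rewrite raddf0.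
Qed.
End DprojMorph.

Section Tensor.
Variables (R : Type) (X Y : zmodType).
Variables (ract : X -> R -> X) (lact : R -> Y -> Y).

(* X (x)_R Y by generators and relations: finite formal sums of pure tensors,
   i.e. lists of pairs, modulo the congruence below. Negatives come from
   (x, y) + (- x, y) = (0, y) = 0. The actions are arbitrary functions, so that
   the same construction serves over the base field and over a noncommutative
   base algebra. The universal property is tlift, tlift_pure and tens_ext. *)
Inductive tens_eq : seq (X * Y) -> seq (X * Y) -> Prop :=
| tens_eq_refl s : tens_eq s s
| tens_eq_sym s t : tens_eq s t -> tens_eq t s
| tens_eq_trans s t u : tens_eq s t -> tens_eq t u -> tens_eq s u
| tens_eq_cat s s' t t' :
    tens_eq s s' -> tens_eq t t' -> tens_eq (s ++ t) (s' ++ t')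
| tens_eq_catC s t : tens_eq (s ++ t) (t ++ s)
| tens_eq_0l y : tens_eq [:: (0, y)] [::]
| tens_eq_Dl x x' y : tens_eq [:: (x + x', y)] [:: (x, y); (x', y)]
| tens_eq_Dr x y y' : tens_eq [:: (x, y + y')] [:: (x, y); (x, y')]
| tens_eq_act x r y : tens_eq [:: (ract x r, y)] [:: (x, lact r y)].

Definition tens_eqb : rel (seq (X * Y)) := fun s t => `[< tens_eq s t >].

Fact tens_eqb_equiv : equiv_class_of tens_eqb.
Proof.
split=> [s|s t|t s u].
- by apply/asboolP; apply: tens_eq_refl.
- by apply/asboolP/asboolP; apply: tens_eq_sym.
- by move=> /asboolP st /asboolP tu; apply/asboolP; apply: tens_eq_trans st tu.
Qed.
Canonical tens_equiv := EquivRelPack tens_eqb_equiv.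
Canonical tens_encModRel := defaultEncModRel tens_eqb.

Definition tens := {eq_quot tens_eqb}.
HB.instance Definition _ := Choice.on tens.

Lemma tens_piP s t : \pi_tens s = \pi_tens t <-> tens_eq s t.
Proof. by split=> [/eqmodP/asboolP //|st]; apply/eqmodP/asboolP. Qed.

Definition tens_add (a b : tens) : tens := \pi_tens (repr a ++ repr b).
Definition tens_opp (a : tens) : tens :=
  \pi_tens [seq (- p.1, p.2) | p <- repr a].
Definition tpure (x : X) (y : Y) : tens := \pi_tens [:: (x, y)].

Lemma tens_W (P : tens -> Prop) : (forall s, P (\pi_tens s)) -> forall t, P t.
Proof. by move=> Ps t; rewrite -[t]reprK. Qed.

Lemma tens_eq_repr s : tens_eq (repr (\pi_tens s)) s.
Proof. by apply/tens_piP; rewrite reprK. Qed.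

Lemma tens_addE s t : tens_add (\pi_tens s) (\pi_tens t) = \pi_tens (s ++ t).
Proof. by apply/tens_piP; apply: tens_eq_cat; apply: tens_eq_repr. Qed.

Lemma tens_oppE s : tens_opp (\pi_tens s) = \pi_tens [seq (- p.1, p.2) | p <- s].
Proof.
apply/tens_piP; have := tens_eq_repr s.
move: (repr _) => s'; elim=> {s s'} [s|s t _|s t u _ st _ tu|s s' t t' _ ss' _ tt'|s t|y
  |x x' y|x y y'|x r y] /=.
- exact: tens_eq_refl.
- exact: tens_eq_sym.
- exact: tens_eq_trans st tu.
- by rewrite !map_cat; apply: tens_eq_cat.
- by rewrite !map_cat; apply: tens_eq_catC.
- by rewrite oppr0; apply: tens_eq_0l.
- by rewrite opprD; apply: tens_eq_Dl.
- exact: tens_eq_Dr.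
- have cancel a b : tens_eq ([:: (a, b)] ++ [:: (- a, b)]) [::].
    apply: tens_eq_trans (tens_eq_0l b); rewrite -(subrr a).
    by apply: tens_eq_sym; apply: tens_eq_Dl.
  apply: (@tens_eq_trans _
     ([:: (- ract x r, y)] ++ ([:: (x, lact r y)] ++ [:: (- x, lact r y)]))).
    rewrite -[X in tens_eq X]cats0; apply: tens_eq_cat; first exact: tens_eq_refl.
    by apply: tens_eq_sym; apply: cancel.
  rewrite catA -[X in tens_eq _ X]cat0s; apply: tens_eq_cat; last exact: tens_eq_refl.
  apply: (tens_eq_trans (tens_eq_catC _ _)).
  apply: tens_eq_trans (cancel (ract x r) y).
  by apply: tens_eq_cat (tens_eq_refl _); apply: tens_eq_sym; apply: tens_eq_act.
Qed.

Fact tens_addA : associative tens_add.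
Proof.
by elim/tens_W=> s; elim/tens_W=> t; elim/tens_W=> u; rewrite !tens_addE catA.
Qed.
Fact tens_addC : commutative tens_add.
Proof.
elim/tens_W=> s; elim/tens_W=> t; rewrite !tens_addE; apply/tens_piP.
exact: tens_eq_catC.
Qed.
Fact tens_add0 : left_id (\pi_tens [::]) tens_add.
Proof. by elim/tens_W=> s; rewrite tens_addE. Qed.
Fact tens_addN : left_inverse (\pi_tens [::]) tens_opp tens_add.
Proof.
have consE p s : \pi_tens (p :: s) = tens_add (\pi_tens [:: p]) (\pi_tens s).
  by rewrite tens_addE.
elim/tens_W=> s; rewrite tens_oppE; elim: s => [|[x y] s IHs].
  by rewrite tens_add0.
rewrite /= consE [X in tens_add _ X]consE -tens_addA.
rewrite [X in tens_add _ X]tens_addC -tens_addA.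
rewrite [X in tens_add _ (tens_add _ X)]tens_addC IHs.
rewrite [X in tens_add _ X]tens_addC tens_add0 tens_addE.
apply/tens_piP; apply: tens_eq_trans (tens_eq_0l y); rewrite -(addNr x).
by apply: tens_eq_sym; apply: tens_eq_Dl.
Qed.

HB.instance Definition _ :=
  GRing.isZmodule.Build tens tens_addA tens_addC tens_add0 tens_addN.

Lemma tpure_sum (t : tens) : t = \sum_(p <- repr t) tpure p.1 p.2.
Proof.
rewrite -[t in LHS]reprK; elim: (repr t) => [|[x y] s IHs]; first by rewrite big_nil.
by rewrite big_cons -IHs -[RHS]/(tens_add _ _) tens_addE.
Qed.

Lemma tpureDl x x' y : tpure (x + x') y = tpure x y + tpure x' y.
Proof.
by rewrite -[RHS]/(tens_add _ _) tens_addE; apply/tens_piP; apply: tens_eq_Dl.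
Qed.
Lemma tpureDr x y y' : tpure x (y + y') = tpure x y + tpure x y'.
Proof.
by rewrite -[RHS]/(tens_add _ _) tens_addE; apply/tens_piP; apply: tens_eq_Dr.
Qed.
Lemma tpure_act x r y : tpure (ract x r) y = tpure x (lact r y).
Proof. by apply/tens_piP; apply: tens_eq_act. Qed.

Definition balanced (Z : zmodType) (f : X -> Y -> Z) : Prop :=
  [/\ forall x x' y, f (x + x') y = f x y + f x' y,
      forall x y y', f x (y + y') = f x y + f x y'
    & forall x r y, f (ract x r) y = f x (lact r y)].

Lemma tpure_balanced : balanced tpure.
Proof. by split; [apply: tpureDl | apply: tpureDr | apply: tpure_act]. Qed.

Section Lift.
Variables (Z : zmodType) (f : X -> Y -> Z) (fbal : balanced f).

Definition tlift of balanced f := fun t : tens => \sum_(p <- repr t) f p.1 p.2.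

Lemma tlift_pi s : tlift fbal (\pi_tens s) = \sum_(p <- s) f p.1 p.2.
Proof.
have [fDl fDr fA] := fbal; rewrite /tlift.
have := tens_eq_repr s.
move: (repr _) => s'; elim=> {s s'} [s|s t _ ->|s t u _ -> _ ->|s s' t t' _ ss' _ tt'|s t
  |y|x x' y|x y y'|x r y] //; rewrite ?big_cat ?big_cons ?big_nil /= ?addr0 //.
- by rewrite ss' tt'.
- exact: addrC.
- by apply: (addrI (f 0 y)); rewrite addr0 -fDl addr0.
Qed.

Lemma tlift_pure x y : tlift fbal (tpure x y) = f x y.
Proof. by rewrite tlift_pi big_seq1. Qed.

Fact tlift_is_additive : zmod_morphism (tlift fbal).
Proof.
suff lD : {morph tlift fbal : a b / a + b >-> a + b}.
  have l0 : tlift fbal 0 = 0 by rewrite -[0]/(\pi_tens [::]) tlift_pi big_nil.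
  move=> a b; rewrite lD; congr (_ + _); apply: (addIr (tlift fbal b)).
  by rewrite -lD !addNr.
elim/tens_W=> s; elim/tens_W=> t.
by rewrite -[_ + _ in LHS]/(tens_add _ _) tens_addE !tlift_pi big_cat.
Qed.
HB.instance Definition _ :=
  GRing.isZmodMorphism.Build tens Z (tlift fbal) tlift_is_additive.
End Lift.

Lemma tens_ext (Z : zmodType) (f g : {additive tens -> Z}) :
  (forall x y, f (tpure x y) = g (tpure x y)) -> f =1 g.
Proof.
by move=> fg t; rewrite (tpure_sum t) !raddf_sum; apply: eq_bigr.
Qed.
End Tensor.

(* An F-algebra is a ring with a central ring morphism from F. The structure
   algType is not used because it requires 1 != 0, whereas the zero algebra has to
   be allowed (e.g. as the endomorphism algebra of the zero module). *)
Record gradedAlgebra (F : fieldType) (G : groupType) := GradedAlgebra {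
  galg_ring :> pzRingType;
  galg_scal : {rmorphism F -> galg_ring};
  galg_scalC : forall c x, galg_scal c * x = x * galg_scal c;
  gcomp : G -> {pred galg_ring};
  gcomp_zmod : forall g, zmod_closed (gcomp g);
  gcomp_scal : forall g c x, x \in gcomp g -> galg_scal c * x \in gcomp g;
  gcomp_direct : direct_decomposition gcomp;
  gcompM : forall g h x y,
    x \in gcomp g -> y \in gcomp h -> x * y \in gcomp (g * h)%g
}.

Arguments galg_scal {F G} A : rename.
Arguments gcomp {F G} A g : rename.
Arguments gcomp_zmod {F G} A g : rename.
Arguments gcomp_direct {F G} A : rename.

Section GradedAlgebraTheory.
Variables (F : fieldType) (G : groupType) (A : gradedAlgebra F G).

Definition aproj : G -> A -> A := dproj (gcomp_zmod A) (gcomp_direct A).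
HB.instance Definition _ g := GRing.isZmodMorphism.Build A A (aproj g)
  (dproj_is_additive (gcomp_zmod A) (gcomp_direct A) g).

Lemma aproj_mem g x : aproj g x \in gcomp A g.
Proof. exact: dproj_mem. Qed.
Lemma aproj_id g h x : x \in gcomp A g -> aproj h x = if g == h then x else 0.
Proof. exact: dproj_id. Qed.
Lemma aproj_sum x : exists s, [/\ uniq s, forall g, g \notin s -> aproj g x = 0
  & x = \sum_(g <- s) aproj g x].
Proof. exact: dproj_sum. Qed.
Lemma gcomp0 g : 0 \in gcomp A g.
Proof. by case: (gcomp_zmod A g). Qed.

Lemma aproj_mull g h (a x : A) : a \in gcomp A g ->
  aproj (g * h)%g (a * x) = a * aproj h x.
Proof.
move=> ag; apply: (@dproj_morph _ _ _ _ _ _ _ _ _ _ (fun k => g * k)%g (a \*o idfun)).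
  exact: mulgI.
by move=> k y; apply: gcompM.
Qed.

Lemma gcomp1 : 1 \in gcomp A 1%g.
Proof.
suff -> : 1 = aproj 1%g 1 by apply: aproj_mem.
have hom g (a : A) : a \in gcomp A g -> a * aproj 1%g 1 = a.
  by move=> ag; rewrite -(@aproj_mull g) // mulg1 mulr1 (aproj_id _ ag) eqxx.
have [s [_ _ E]] := aproj_sum 1.
rewrite -[RHS]mul1r [X in _ = X * _]E mulr_suml [LHS]E; apply: eq_bigr => g _.
by rewrite (hom g) ?aproj_mem.
Qed.

(* The product A_g A_h: finite sums of products of homogeneous elements. *)
Definition gcomp_prod (g h : G) : {pred A} := fun z =>
  `[< exists s : seq (A * A),
        all (fun p => (p.1 \in gcomp A g) && (p.2 \in gcomp A h)) s /\
        z = \sum_(p <- s) p.1 * p.2 >].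

Definition strongly_graded : Prop :=
  forall g h : G, gcomp_prod g h =i gcomp A (g * h)%g.

Definition base_pred : {pred A} := gcomp A 1%g.

Fact base_subring : subring_closed base_pred.
Proof.
split; first exact: gcomp1.
  by case: (gcomp_zmod A 1%g).
by move=> x y xe ye; rewrite /base_pred -[1%g]mulg1; apply: gcompM.
Qed.
HB.instance Definition _ := GRing.isSubringClosed.Build A base_pred base_subring.

Record base := Base { base_val : A; base_valP : base_val \in base_pred }.
HB.instance Definition _ := [isSub for base_val].
HB.instance Definition _ := [Choice of base by <:].
HB.instance Definition _ :=
  GRing.SubChoice_isSubPzRing.Build A base_pred base base_subring.

Fact base_scal_subproof c : galg_scal A c \in base_pred.
Proof. by rewrite -[galg_scal A c]mulr1; apply: gcomp_scal; apply: gcomp1. Qed.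
Definition base_scal (c : F) : base := Base (base_scal_subproof c).

Lemma aproj_mulr g (x : A) (a : base) :
  aproj g (x * base_val a) = aproj g x * base_val a.
Proof.
apply: (@dproj_morph _ _ _ _ _ _ _ _ _ _ id (base_val a \o* idfun)) => //.
by move=> k y yk; rewrite -[k]mulg1; apply: gcompM => //; apply: base_valP.
Qed.

Lemma aproj_scal g (x : A) c : aproj g (x * galg_scal A c) = aproj g x * galg_scal A c.
Proof. exact: (aproj_mulr g x (base_scal c)). Qed.
End GradedAlgebraTheory.

(* A bijective degree-preserving morphism has a degree-preserving inverse, since
   the homogeneous components are in direct sum. *)
Record gradedAlgIso (F : fieldType) (G : groupType) (A B : gradedAlgebra F G)
    (f : {rmorphism A -> B}) : Prop := GradedAlgIso {
  galgIso_bij : bijective f;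
  galgIso_scal : forall c, f (galg_scal A c) = galg_scal B c;
  galgIso_deg : forall g x, x \in gcomp A g -> f x \in gcomp B g
}.
Definition gradedAlg_isomorphic (F : fieldType) (G : groupType) (A B : gradedAlgebra F G) :=
  exists f : {rmorphism A -> B}, gradedAlgIso f.

(* The components of a graded module are only required to be subgroups: they are
   F-subspaces because F acts through the base algebra. *)
Record gradedModule (F : fieldType) (G : groupType) (A : gradedAlgebra F G) :=
    GradedModule {
  gmod :> lmodType A;
  mcomp : G -> {pred gmod};
  mcomp_zmod : forall g, zmod_closed (mcomp g);
  mcomp_direct : direct_decomposition mcomp;
  mcompZ : forall g h x w,
    x \in gcomp A g -> w \in mcomp h -> x *: w \in mcomp (g * h)%g
}.

Arguments mcomp {F G A} W g : rename.
Arguments mcomp_zmod {F G A} W g : rename.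
Arguments mcomp_direct {F G A} W : rename.

Section GradedModuleTheory.
Variables (F : fieldType) (G : groupType) (A : gradedAlgebra F G).
Implicit Types W : gradedModule A.

Definition gradedMod_isomorphic W W' : Prop :=
  exists2 f : {linear W -> W'}, bijective f &
    forall g w, w \in mcomp W g -> f w \in mcomp W' g.

Section Suspension.
Variables (h : G) (W : gradedModule A).
Definition susp_comp (g : G) : {pred W} := mcomp W (g * h)%g.
Fact susp_zmod g : zmod_closed (susp_comp g).
Proof. exact: mcomp_zmod. Qed.
Fact susp_direct : direct_decomposition susp_comp.
Proof.
have [dec ind] := mcomp_direct W; split=> [w|s f us fC s0 g gs].
  have [s [f [us fC ->]]] := dec w.
  exists [seq (g * h^-1)%g | g <- s], (fun g => f (g * h)%g); split.
  - by rewrite map_inj_uniq //; apply: mulIg.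
  - by move=> g; apply: fC.
  - by rewrite big_map; apply: eq_bigr => g _; rewrite mulgVK.
have := ind [seq (g * h)%g | g <- s] (fun g => f (g * h^-1)%g).
rewrite map_inj_uniq; last exact: mulIg.
rewrite big_map; under eq_bigr do rewrite mulgK.
move=> /(_ us _ s0 (g * h)%g); rewrite mulgK; apply; last exact: map_f.
by move=> k; have := fC (k * h^-1)%g; rewrite /susp_comp mulgVK.
Qed.
Fact suspZ g k x w :
  x \in gcomp A g -> w \in susp_comp k -> x *: w \in susp_comp (g * k)%g.
Proof. by move=> xg wk; rewrite /susp_comp -mulgA; apply: mcompZ. Qed.
Definition suspension : gradedModule A :=
  GradedModule susp_zmod susp_direct suspZ.
End Suspension.

Section Largest.
Variable W : gradedModule A.

Definition mproj : G -> W -> W := dproj (mcomp_zmod W) (mcomp_direct W).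
HB.instance Definition _ g := GRing.isZmodMorphism.Build W W (mproj g)
  (dproj_is_additive (mcomp_zmod W) (mcomp_direct W) g).
Lemma mproj_mem g x : mproj g x \in mcomp W g.
Proof. exact: dproj_mem. Qed.
Lemma mproj_id g h x : x \in mcomp W g -> mproj h x = if g == h then x else 0.
Proof. exact: dproj_id. Qed.
Lemma mproj_sum x : exists s, [/\ uniq s, forall g, g \notin s -> mproj g x = 0
  & x = \sum_(g <- s) mproj g x].
Proof. exact: dproj_sum. Qed.

Definition graded_submodule (N : {pred W}) : Prop :=
  submod_closed N /\
  {in N, forall w, in_sum (fun g => [predI mcomp W g & N]) w}.

Lemma graded_submodule_proj N g w :
  graded_submodule N -> w \in N -> mproj g w \in N.
Proof.
move=> [[N0 _] Ng] /Ng[s [f [us fN ->]]].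
rewrite raddf_sum /=.
suff -> : \sum_(k <- s) mproj g (f k) = if g \in s then f g else 0.
  by case: ifP => // _; case/andP: (fN g).
rewrite (eq_bigr (fun k => if k == g then f k else 0)).
  rewrite -big_mkcond -big_filter; case: ifPn => gs.
    by rewrite filter_pred1_uniq // big_seq1.
  rewrite (_ : filter _ _ = [::]) ?big_nil //.
  by apply/eqP; rewrite -[_ == _]negbK -has_filter has_pred1.
by move=> k _; apply: mproj_id; case/andP: (fN k).
Qed.

(* The largest graded submodule with zero e-component, defined as the union of all
   of them; tmax_graded, tmax_e and tmax_max show that it is the largest one. *)
Definition tmax : {pred W} := fun w => `[< exists N : {pred W},
  [/\ graded_submodule N, {in N, forall x, x \in mcomp W 1%g -> x = 0} & w \in N] >].

Lemma tmax_max N : graded_submodule N ->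
  {in N, forall x, x \in mcomp W 1%g -> x = 0} -> {subset N <= tmax}.
Proof. by move=> Ng N1 w wN; apply/asboolP; exists N. Qed.

Lemma tmax_e : {in tmax, forall x, x \in mcomp W 1%g -> x = 0}.
Proof. by move=> x /asboolP[N [_ + xN]]; apply. Qed.

Fact tmax_submod : submod_closed tmax.
Proof.
split.
  apply/asboolP; exists (fun w => w == 0); split; last exact: eqxx.
    split; first split; first exact: eqxx.
      by move=> a u v /eqP-> /eqP->; rewrite scaler0 addr0; apply: eqxx.
    move=> w /eqP->; exists [::], (fun _ => 0); split=> // [g|].
      by apply/andP; split; [case: (mcomp_zmod W g) | apply: eqxx].
    by rewrite big_nil.
  by move=> x /eqP.
move=> a u v /asboolP[N [Ng N1 uN]] /asboolP[N' [Ng' N1' vN']].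
apply: (@tmax_max (fun w => `[< exists x y, [/\ x \in N, y \in N' & w = x + y] >])).
- split; first split.
  + by apply/asboolP; exists 0, 0; rewrite addr0; case: Ng.1 => -> _; case: Ng'.1.
  + move=> b _ _ /asboolP[x [y [xN yN ->]]] /asboolP[x' [y' [xN' yN' ->]]].
    apply/asboolP; exists (b *: x + x'), (b *: y + y'); split.
    * by case: Ng.1 => _; apply.
    * by case: Ng'.1 => _; apply.
    * by rewrite scalerDr addrACA.
  + move=> w wN; have [s [us _ ws]] := mproj_sum w.
    exists s, (mproj^~ w); split=> // g; apply/andP; split; first exact: mproj_mem.
    have /asboolP[x [y [xN yN ->]]] := wN; apply/asboolP.
    exists (mproj g x), (mproj g y); rewrite raddfD.
    by split=> //; apply: graded_submodule_proj.
- move=> w /asboolP[x [y [xN yN ->]]] w1.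
  have := mproj_id 1%g w1; rewrite eqxx raddfD /= => <-.
  rewrite (N1 _ (graded_submodule_proj 1%g Ng xN) (mproj_mem 1%g x)) add0r.
  exact: (N1' _ (graded_submodule_proj 1%g Ng' yN) (mproj_mem 1%g y)).
- apply/asboolP; exists (a *: u), v; split=> //.
  by case: Ng.1 => N0 /(_ a u 0 uN N0); rewrite addr0.
Qed.
HB.instance Definition _ := GRing.isZmodClosed.Build W tmax
  (GRing.submod_closedB tmax_submod).
Fact tmaxZ : GRing.scaler_closed tmax.
Proof. exact: GRing.subsemimod_closedZ (GRing.submod_closed_semi tmax_submod). Qed.

Lemma tmax_graded : graded_submodule tmax.
Proof.
split; first exact: tmax_submod.
move=> w /asboolP[N [Ng N1 wN]]; have [s [us _ ws]] := mproj_sum w.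
exists s, (mproj^~ w); split=> // g; rewrite inE mproj_mem /=.
by apply: (tmax_max Ng N1); apply: graded_submodule_proj.
Qed.
End Largest.
End GradedModuleTheory.

Section QuotientModule.
Variables (R : pzRingType) (V : lmodType R) (S : zmodClosed V).
Hypothesis SZ : GRing.scaler_closed S.

(* The proof argument only serves to attach the module structure to the quotient. *)
Definition qmodule of GRing.scaler_closed S : Type := Quotient.quot S.
Local Notation qmod := (qmodule SZ).
HB.instance Definition _ := GRing.Zmodule.on qmod.
Definition qproj (v : V) : qmod := \pi_(Quotient.quot S) v.
Fact qproj_is_additive : zmod_morphism qproj.
Proof. by move=> u v; rewrite /qproj raddfB. Qed.
HB.instance Definition _ := GRing.isZmodMorphism.Build V qmod qproj qproj_is_additive.

Lemma qproj_eq u v : (qproj u == qproj v) = (u - v \in S).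
Proof. by rewrite Quotient.idealrBE. Qed.
Lemma qproj_eq0 v : (qproj v == 0) = (v \in S).
Proof. by rewrite -(raddf0 qproj) qproj_eq subr0. Qed.
Lemma qproj_W (P : qmod -> Prop) : (forall v, P (qproj v)) -> forall q, P q.
Proof. by move=> Pv q; rewrite -[q]reprK; apply: Pv. Qed.

Definition qscale (a : R) (q : qmod) : qmod := qproj (a *: repr q).
Lemma qscaleE a v : qscale a (qproj v) = qproj (a *: v).
Proof.
apply/eqP; rewrite qproj_eq -scalerBr; apply: SZ.
by rewrite -qproj_eq /qproj reprK eqxx.
Qed.
Fact qscaleA a b q : qscale a (qscale b q) = qscale (a * b) q.
Proof. by elim/qproj_W: q => v; rewrite !qscaleE scalerA. Qed.
Fact qscale1 : left_id 1 qscale.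
Proof. by elim/qproj_W => v; rewrite !qscaleE scale1r. Qed.
Fact qscaleDr : right_distributive qscale +%R.
Proof.
move=> a; elim/qproj_W => u; elim/qproj_W => v.
by rewrite -raddfD !qscaleE -raddfD scalerDr.
Qed.
Fact qscaleDl q : {morph qscale^~ q : a b / a + b}.
Proof. by elim/qproj_W: q => v a b /=; rewrite !qscaleE -raddfD scalerDl. Qed.
HB.instance Definition _ := GRing.Zmodule_isLmodule.Build R qmod
  qscaleA qscale1 qscaleDr qscaleDl.
End QuotientModule.

Section AssociatedGraded.
Variables (F : fieldType) (G : groupType) (A : gradedAlgebra F G).
Variable (W : gradedModule A).
Local Notation Q := (qmodule (@tmaxZ F G A W)).
Local Notation q := (qproj (@tmaxZ F G A W)).

Definition assoc_comp (g : G) : {pred Q} :=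
  fun x => `[< exists2 w, w \in mcomp W g & x = q w >].

Fact assoc_zmod g : zmod_closed (assoc_comp g).
Proof.
have [W0 WB] := mcomp_zmod W g; split.
  by apply/asboolP; exists 0; rewrite ?raddf0.
move=> _ _ /asboolP[u ug ->] /asboolP[v vg ->].
by apply/asboolP; exists (u - v); rewrite ?raddfB //; apply: WB.
Qed.

Fact assoc_direct : direct_decomposition assoc_comp.
Proof.
split.
  elim/qproj_W => w; have [s [us _ {1}->]] := mproj_sum w.
  exists s, (fun g => q (mproj g w)); split; rewrite ?raddf_sum //.
  by move=> g; apply/asboolP; exists (mproj g w); rewrite ?mproj_mem.
move=> s f us fC sf0 g gs.
have lift k : exists w, w \in mcomp W k /\ f k = q w.
  by have /asboolP[w wk ->] := fC k; exists w.
pose l k := sval (cid (lift k)).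
have lP k : l k \in mcomp W k /\ f k = q (l k) by apply: svalP (cid (lift k)).
have tl : \sum_(k <- s) l k \in @tmax F G A W.
  suff E : q (\sum_(k <- s) l k) = \sum_(k <- s) f k.
    by rewrite -(qproj_eq0 (@tmaxZ F G A W)) E sf0.
  by rewrite raddf_sum; apply: eq_bigr => k _; have [_ ->] := lP k.
have [_ ->] := lP g; apply/eqP; rewrite qproj_eq0.
have := graded_submodule_proj g (tmax_graded W) tl.
rewrite raddf_sum /= (bigD1_seq g) //= big1 ?addr0; last first.
  by move=> k /negbTE kg; have [lk _] := lP k; rewrite (mproj_id _ lk) kg.
by have [lk _] := lP g; rewrite (mproj_id _ lk) eqxx.
Qed.
Fact assocZ g h (a : A) x : a \in gcomp A g -> x \in assoc_comp h ->
  a *: x \in assoc_comp (g * h)%g.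
Proof.
move=> ag /asboolP[w wh ->]; apply/asboolP; exists (a *: w); first exact: mcompZ.
exact: qscaleE.
Qed.
Definition assoc_graded : gradedModule A :=
  GradedModule assoc_zmod assoc_direct assocZ.
End AssociatedGraded.

Section TensorSpan.
Variables (R : Type) (X Y : zmodType).
Variables (ract : X -> R -> X) (lact : R -> Y -> Y).
Local Notation T := (tens ract lact).
Local Notation tpure := (tpure ract lact).

Definition tspan (P : {pred X}) (Q : {pred Y}) : {pred T} := fun t =>
  `[< exists s : seq (X * Y), all (fun p => (p.1 \in P) && (p.2 \in Q)) s /\
        t = \sum_(p <- s) tpure p.1 p.2 >].

Lemma tpure0l y : tpure 0 y = 0.
Proof. by apply: (addrI (tpure 0 y)); rewrite -tpureDl !addr0. Qed.
Lemma tpureNl x y : tpure (- x) y = - tpure x y.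
Proof. by apply: (addrI (tpure x y)); rewrite -tpureDl !subrr tpure0l. Qed.

Lemma tpureNr x y : tpure x (- y) = - tpure x y.
Proof.
have tpure0r : tpure x 0 = 0 by apply: (addrI (tpure x 0)); rewrite -tpureDr !addr0.
by apply: (addrI (tpure x y)); rewrite -tpureDr !subrr.
Qed.

Lemma tpure_suml (J : Type) (r : seq J) (f : J -> X) y :
  \sum_(j <- r) tpure (f j) y = tpure (\sum_(j <- r) f j) y.
Proof.
elim: r => [|j r IHr]; first by rewrite !big_nil tpure0l.
by rewrite !big_cons IHr tpureDl.
Qed.

Lemma tspan_pure P Q x y : x \in P -> y \in Q -> tpure x y \in tspan P Q.
Proof.
move=> xP yQ; apply/asboolP; exists [:: (x, y)].
by rewrite /= xP yQ big_seq1.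
Qed.

Lemma tspan_zmod P Q : zmod_closed P -> zmod_closed (tspan P Q).
Proof.
move=> [P0 PB]; split.
  by apply/asboolP; exists [::]; rewrite big_nil.
move=> _ _ /asboolP[s [sP ->]] /asboolP[s' [sP' ->]]; apply/asboolP.
exists (s ++ [seq (- p.1, p.2) | p <- s']); split.
  rewrite all_cat sP /= all_map; apply: sub_all sP' => p /= /andP[p1 ->].
  by rewrite andbT -[- p.1]add0r; apply: PB.
rewrite big_cat big_map -sumrN; congr (_ + _); apply: eq_bigr => p _.
by rewrite tpureNl.
Qed.

Lemma tspan_additive (Z : zmodType) (f : {additive T -> Z}) (S : {pred Z}) P Q :
  zmod_closed S -> (forall x y, x \in P -> y \in Q -> f (tpure x y) \in S) ->
  {in tspan P Q, forall t, f t \in S}.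
Proof.
move=> [S0 SB] fS t /asboolP[s [sP ->]]; rewrite raddf_sum.
elim: s sP => [|p s IHs] /=; first by rewrite big_nil.
move=> /andP[/andP[pP pQ] /IHs sS]; rewrite big_cons addrC -[X in _ + X]opprK.
by apply: (SB) => //; rewrite -sub0r; apply: (SB) => //; apply: fS.
Qed.

Section Graded.
Variables (I : choiceType) (C : I -> {pred X}).
Hypotheses (Cz : forall i, zmod_closed (C i)) (Cd : direct_decomposition C).
Hypothesis dact : forall i x r, dproj Cz Cd i (ract x r) = ract (dproj Cz Cd i x) r.

Fact tproj_balanced i :
  balanced ract lact (fun x y => tpure (dproj Cz Cd i x) y).
Proof.
split=> [x x' y|x y y'|x r y]; first by rewrite raddfD tpureDl.
  by rewrite tpureDr.
by rewrite dact tpure_act.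
Qed.
Definition tproj i : T -> T := tlift (tproj_balanced i).
HB.instance Definition _ i := GRing.isZmodMorphism.Build T T (tproj i)
  (tlift_is_additive (tproj_balanced i)).

Lemma tproj_tspan i j Q t :
  t \in tspan (C i) Q -> tproj j t = if i == j then t else 0.
Proof.
move=> /asboolP[s [sP ->]]; rewrite raddf_sum.
have E : \sum_(p <- s) tproj j (tpure p.1 p.2) =
         \sum_(p <- s) if i == j then tpure p.1 p.2 else 0.
  apply: eq_big_seq => p /(allP sP)/andP[p1 _].
  by rewrite /tproj tlift_pure (dproj_id Cz Cd _ p1); case: eqP; rewrite ?tpure0l.
by rewrite E; case: eqP => // _; rewrite big1.
Qed.

Lemma tspan_indep (Q : I -> {pred Y}) (s : seq I) (f : I -> T) :
  uniq s -> (forall i, f i \in tspan (C i) (Q i)) ->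
  \sum_(i <- s) f i = 0 -> {in s, forall i, f i = 0}.
Proof.
move=> us fC sf i si; have := congr1 (tproj i) sf; rewrite raddf0 raddf_sum.
rewrite (bigD1_seq i) //= big1 => [|j /negbTE ji].
  by rewrite addr0 (tproj_tspan i (fC i)) eqxx.
by rewrite (tproj_tspan i (fC j)) ji.
Qed.
End Graded.
End TensorSpan.

Arguments tspan {R X Y} ract lact P Q.

Section InducedModule.
Variables (F : fieldType) (G : groupType) (A : gradedAlgebra F G).
Variable M : lmodType (base A).

Definition ind_ract (x : A) (a : base A) : A := x * base_val a.
Definition ind_lact (a : base A) (m : M) : M := a *: m.
Definition ind := tens ind_ract ind_lact.
HB.instance Definition _ := GRing.Zmodule.on ind.
Local Notation "x *t m" := (tpure ind_ract ind_lact x m : ind) (at level 40).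

Fact ind_scale_balanced (a : A) :
  balanced ind_ract ind_lact (fun x m => (a * x) *t m).
Proof.
split=> [x x' m|x m m'|x b m]; first by rewrite mulrDr tpureDl.
  by rewrite tpureDr.
by rewrite -tpure_act /ind_ract mulrA.
Qed.
Definition ind_scale (a : A) (t : ind) : ind := tlift (ind_scale_balanced a) t.
HB.instance Definition _ a := GRing.isZmodMorphism.Build ind ind (ind_scale a)
  (tlift_is_additive (ind_scale_balanced a)).
Lemma ind_scale_pure a x m : ind_scale a (x *t m) = (a * x) *t m.
Proof. exact: tlift_pure. Qed.

Lemma ind_ext (f g : {additive ind -> ind}) :
  (forall x m, f (x *t m) = g (x *t m)) -> f =1 g.
Proof. exact: tens_ext. Qed.

Fact ind_scaleA a b t : ind_scale a (ind_scale b t) = ind_scale (a * b) t.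
Proof.
apply: (@ind_ext (ind_scale a \o ind_scale b) (ind_scale (a * b))) t => x m /=.
by rewrite !ind_scale_pure mulrA.
Qed.
Fact ind_scale1 : left_id 1 ind_scale.
Proof.
by apply: (@ind_ext (ind_scale 1) idfun) => x m /=; rewrite ind_scale_pure mul1r.
Qed.
Fact ind_scaleDr : right_distributive ind_scale +%R.
Proof. by move=> a t u; rewrite raddfD. Qed.
Fact ind_scaleDl t : {morph ind_scale^~ t : a b / a + b}.
Proof.
move=> a b; apply: (@ind_ext (ind_scale (a + b)) (ind_scale a \+ ind_scale b)) t => x m /=.
by rewrite !ind_scale_pure mulrDl tpureDl.
Qed.
HB.instance Definition _ := GRing.Zmodule_isLmodule.Build A ind
  ind_scaleA ind_scale1 ind_scaleDr ind_scaleDl.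

(* The image of A_g (x) M in A (x) M. *)
Definition ind_comp (g : G) : {pred ind} :=
  tspan ind_ract ind_lact (gcomp A g) predT.

Fact ind_zmod g : zmod_closed (ind_comp g).
Proof. exact/tspan_zmod/gcomp_zmod. Qed.

Fact ind_direct : direct_decomposition ind_comp.
Proof.
have dact g x b : dproj (gcomp_zmod A) (gcomp_direct A) g (ind_ract x b) =
    ind_ract (dproj (gcomp_zmod A) (gcomp_direct A) g x) b by apply: aproj_mulr.
split; last by move=> s f; apply: (tspan_indep (Q := fun=> predT) dact).
move=> t; rewrite [t]tpure_sum; apply: in_sum_sum => [|[x m] _ /=]; first exact: ind_zmod.
have [r [_ _ ->]] := aproj_sum x.
rewrite -(tpure_suml ind_ract ind_lact); apply: in_sum_sum => [|g _]; first exact: ind_zmod.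
apply: (@in_sum_comp _ _ _ ind_zmod g); apply: tspan_pure => //; exact: aproj_mem.
Qed.

Fact indZ g h (a : A) (t : ind) : a \in gcomp A g -> t \in ind_comp h ->
  a *: t \in ind_comp (g * h)%g.
Proof.
move=> ag; apply: (tspan_additive (f := ind_scale a) (ind_zmod _)) => x m xh _ /=.
by rewrite ind_scale_pure; apply: tspan_pure => //; apply: gcompM.
Qed.

Definition induced : gradedModule A := GradedModule ind_zmod ind_direct indZ.
End InducedModule.

Section TensorAlgebra.
Variables (F : fieldType) (G : groupType) (A B : gradedAlgebra F G).

Definition talg_ract (x : A) (c : F) : A := x * galg_scal A c.
Definition talg_lact (c : F) (y : B) : B := galg_scal B c * y.
Local Notation T := (tens talg_ract talg_lact).
Local Notation "x *t y" := (tpure talg_ract talg_lact x y) (at level 40).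

Fact tmul_in_balanced x y :
  balanced talg_ract talg_lact (fun x' y' => (x * x') *t (y * y')).
Proof.
split=> [x1 x2 y'|x' y1 y2|x' c y']; first by rewrite mulrDr tpureDl.
  by rewrite mulrDr tpureDr.
rewrite /talg_ract /talg_lact mulrA -/(talg_ract _ c) tpure_act.
by rewrite /talg_lact !mulrA galg_scalC.
Qed.
Definition tmul_l x y : T -> T := tlift (tmul_in_balanced x y).
HB.instance Definition _ x y := GRing.isZmodMorphism.Build T T (tmul_l x y)
  (tlift_is_additive (tmul_in_balanced x y)).
Lemma tmul_l_pure x y x' y' : tmul_l x y (x' *t y') = (x * x') *t (y * y').
Proof. exact: tlift_pure. Qed.

Fact tmul_out_balanced u : balanced talg_ract talg_lact (fun x y => tmul_l x y u).
Proof.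
split=> [x x' y|x y y'|x c y].
- apply: (tens_ext (g := tmul_l x y \+ tmul_l x' y) (f := tmul_l (x + x') y)) u => a b /=.
  by rewrite !tmul_l_pure mulrDl tpureDl.
- apply: (tens_ext (g := tmul_l x y \+ tmul_l x y') (f := tmul_l x (y + y'))) u => a b /=.
  by rewrite !tmul_l_pure mulrDl tpureDr.
- apply: (tens_ext (f := tmul_l (talg_ract x c) y) (g := tmul_l x (talg_lact c y))) u => a b /=.
  rewrite !tmul_l_pure /talg_ract /talg_lact -mulrA galg_scalC mulrA.
  by rewrite -/(talg_ract _ c) tpure_act /talg_lact mulrA.
Qed.
Definition tmul (t u : T) : T := tlift (tmul_out_balanced u) t.

Lemma tmul_pure x y x' y' : tmul (x *t y) (x' *t y') = (x * x') *t (y * y').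
Proof. by rewrite /tmul tlift_pure tmul_l_pure. Qed.

Fact tmulDl : left_distributive tmul +%R.
Proof. by move=> t u v; rewrite /tmul raddfD. Qed.
Fact tmul0l t : tmul 0 t = 0.
Proof. by rewrite /tmul raddf0. Qed.

Fact tmulDr : right_distributive tmul +%R.
Proof.
move=> t u v; rewrite /tmul /tlift -big_split; apply: eq_bigr => p _ /=.
by rewrite raddfD.
Qed.
Fact tmul0r t : tmul t 0 = 0.
Proof. by apply: (addrI (tmul t 0)); rewrite -tmulDr !addr0. Qed.

Lemma tens_gen (P : T -> Prop) : P 0 -> (forall t u, P t -> P u -> P (t + u)) ->
  (forall x y, P (x *t y)) -> forall t, P t.
Proof. by move=> P0 PD Pp t; rewrite [t]tpure_sum; apply: big_ind. Qed.

Fact tmulA : associative tmul.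
Proof.
elim/tens_gen=> [u v|t t' IH IH' u v|x y]; first by rewrite !tmul0l.
  by rewrite !tmulDl IH IH'.
elim/tens_gen=> [v|t t' IH IH' v|x1 y1]; first by rewrite !(tmul0l, tmul0r).
  by rewrite !(tmulDl, tmulDr) IH IH'.
elim/tens_gen=> [|t t' IH IH'|x2 y2]; first by rewrite !tmul0r.
  by rewrite !tmulDr IH IH'.
by rewrite !tmul_pure !mulrA.
Qed.
Fact tmul1l : left_id (1 *t 1) tmul.
Proof.
elim/tens_gen=> [|t t' IH IH'|x y]; first by rewrite tmul0r.
  by rewrite tmulDr IH IH'.
by rewrite tmul_pure !mul1r.
Qed.
Fact tmul1r : right_id (1 *t 1) tmul.
Proof.
elim/tens_gen=> [|t t' IH IH'|x y]; first by rewrite tmul0l.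
  by rewrite tmulDl IH IH'.
by rewrite tmul_pure !mulr1.
Qed.

Definition talg := T.
HB.instance Definition _ := GRing.Zmodule.on talg.
HB.instance Definition _ :=
  GRing.Zmodule_isPzRing.Build talg tmulA tmul1l tmul1r tmulDl tmulDr.
Definition talg_pure (x : A) (y : B) : talg := x *t y.

Lemma talg_pureM x y x' y' :
  talg_pure x y * talg_pure x' y' = talg_pure (x * x') (y * y').
Proof. exact: tmul_pure. Qed.

(* The image of A_g (x) B_g in A (x) B; over a field it is isomorphic to the tensor
   product of the components. *)
Definition gpr_comp (g : G) : {pred talg} :=
  tspan talg_ract talg_lact (gcomp A g) (gcomp B g).
Fact gpr_comp_zmod g : zmod_closed (gpr_comp g).
Proof. exact/tspan_zmod/gcomp_zmod. Qed.

Lemma gpr_compM g h t u :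
  t \in gpr_comp g -> u \in gpr_comp h -> t * u \in gpr_comp (g * h)%g.
Proof.
move=> tg uh.
suff H : {in gpr_comp h, forall u, (t \*o idfun) u \in gpr_comp (g * h)%g}.
  exact: H.
apply: tspan_additive (gpr_comp_zmod _) _ => x y xh yh.
suff H : {in gpr_comp g, forall t,
    (talg_pure x y \o* idfun) t \in gpr_comp (g * h)%g} by exact: H.
apply: tspan_additive (gpr_comp_zmod _) _ => x' y' xg yg.
by rewrite /= -/(talg_pure _ _) talg_pureM; apply: tspan_pure; apply: gcompM.
Qed.

Definition gpr_pred : {pred talg} := fun t => `[< in_sum gpr_comp t >].

Lemma gpr_comp_pred g t : t \in gpr_comp g -> t \in gpr_pred.
Proof. by move=> tg; apply/asboolP; apply: (in_sum_comp gpr_comp_zmod tg). Qed.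

Fact gpr_subring : subring_closed gpr_pred.
Proof.
split.
- by apply: (@gpr_comp_pred 1%g); apply: tspan_pure; apply: gcomp1.
- move=> t u /asboolP tG /asboolP uG; apply/asboolP.
  exact: (in_sumB gpr_comp_zmod tG uG).
move=> _ _ /asboolP[s [f [_ fC ->]]] /asboolP[s' [f' [_ fC' ->]]].
apply/asboolP; rewrite mulr_suml; apply: (in_sum_sum gpr_comp_zmod) => g _.
rewrite mulr_sumr; apply: (in_sum_sum gpr_comp_zmod) => h _.
exact: (in_sum_comp gpr_comp_zmod (gpr_compM (fC g) (fC' h))).
Qed.
HB.instance Definition _ := GRing.isSubringClosed.Build talg gpr_pred gpr_subring.

Record gpr := Gpr { gpr_val : talg; gpr_valP : gpr_val \in gpr_pred }.
HB.instance Definition _ := [isSub for gpr_val].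
HB.instance Definition _ := [Choice of gpr by <:].
HB.instance Definition _ :=
  GRing.SubChoice_isSubPzRing.Build talg gpr_pred gpr gpr_subring.

Fact gpr_pure_subproof g x y : x \in gcomp A g -> y \in gcomp B g ->
  talg_pure x y \in gpr_pred.
Proof. by move=> xg yg; apply: (@gpr_comp_pred g); apply: tspan_pure. Qed.

Definition gpr_scal (c : F) : gpr := Gpr
  (gpr_pure_subproof (base_valP (base_scal A c)) (gcomp1 B)).

Fact gpr_scal_additive : zmod_morphism gpr_scal.
Proof.
move=> c d; apply: val_inj; rewrite raddfB /= rmorphB.
by rewrite /talg_pure tpureDl tpureNl.
Qed.
Fact gpr_scal_multiplicative : monoid_morphism gpr_scal.
Proof.
split=> [|c d]; apply: val_inj; first by rewrite /= rmorph1.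
by rewrite rmorphM /= rmorphM talg_pureM mulr1.
Qed.
HB.instance Definition _ := GRing.isZmodMorphism.Build F gpr gpr_scal gpr_scal_additive.
HB.instance Definition _ := GRing.isMonoidMorphism.Build F gpr gpr_scal gpr_scal_multiplicative.

Fact gpr_scalC c x : gpr_scal c * x = x * gpr_scal c.
Proof.
apply: val_inj; rewrite !rmorphM /=; elim/tens_gen: (gpr_val x) => [|t u IHt IHu|a b].
- by rewrite -[0 in LHS]/(0 : talg) mulr0 mul0r.
- by rewrite -[t + u in LHS]/((t : talg) + u) mulrDr mulrDl IHt IHu.
- by rewrite -/(talg_pure a b) !talg_pureM mulr1 mul1r galg_scalC.
Qed.

Definition gprod_comp (g : G) : {pred gpr} := fun x => gpr_val x \in gpr_comp g.

Fact gprod_zmod g : zmod_closed (gprod_comp g).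
Proof.
have [C0 CB] := gpr_comp_zmod g.
split=> [|x y xg yg]; first exact: C0.
by have := CB _ _ xg yg; rewrite -(raddfB (val : gpr -> talg)).
Qed.

Fact gprod_compM g h x y :
  x \in gprod_comp g -> y \in gprod_comp h -> x * y \in gprod_comp (g * h)%g.
Proof. by move=> xg yh; have := gpr_compM xg yh; rewrite -(rmorphM (val : gpr -> talg)). Qed.

Fact gprod_comp_scal g c x : x \in gprod_comp g -> gpr_scal c * x \in gprod_comp g.
Proof.
move=> xg; rewrite -[g]mul1g; apply: gprod_compM => //.
apply: tspan_pure; [exact: base_valP (base_scal A c) | exact: gcomp1].
Qed.

Fact gprod_direct : direct_decomposition gprod_comp.
Proof.
split=> [[x xG]|s f us fC sf g gs].
  have /asboolP[s [f [us fC E]]] := xG.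
  exists s, (fun g => Gpr (gpr_comp_pred (fC g))); split=> //.
  by apply: val_inj; rewrite raddf_sum.
apply: val_inj; rewrite (raddf0 (val : gpr -> talg)).
apply: (tspan_indep (@aproj_scal F G A) us fC _ gs).
by have := congr1 val sf; rewrite raddf_sum raddf0.
Qed.

Definition gprod : gradedAlgebra F G := GradedAlgebra
  gpr_scalC gprod_zmod gprod_comp_scal gprod_direct gprod_compM.

End TensorAlgebra.

Section RightEndomorphisms.
Variables (F : fieldType) (G : groupType) (A : gradedAlgebra F G).
Variable W : gradedModule A.

Definition endr_comp (h : G) : {pred W -> W} := fun f =>
  `[< linear f /\ forall g w, w \in mcomp W g -> f w \in mcomp W (g * h)%g >].

Definition endr_pred : {pred W -> W} := fun f => `[< in_sum endr_comp f >].

Fact endr_comp_zmod h : zmod_closed (endr_comp h).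
Proof.
split.
  apply/asboolP; split=> [a u v|g w _]; first by rewrite scaler0 addr0.
  by case: (mcomp_zmod W (g * h)%g).
move=> f f' /asboolP[fl fh] /asboolP[fl' fh']; apply/asboolP; split.
  move=> a u v /=; rewrite -[LHS]/(f _ - f' _) -[RHS]/(a *: (f _ - f' _) + (f _ - f' _)).
  by rewrite fl fl' scalerBr opprD addrACA.
move=> g w wg; rewrite -[_ w]/(f w - f' w).
by case: (mcomp_zmod W (g * h)%g) => _; apply; [apply: fh | apply: fh'].
Qed.

Fact endr_zmod : zmod_closed endr_pred.
Proof.
split=> [|f f' /asboolP fG /asboolP fG']; apply/asboolP.
  exact: (in_sum0 endr_comp_zmod).
exact: (in_sumB endr_comp_zmod).
Qed.

Lemma endr_comp_pred h f : f \in endr_comp h -> f \in endr_pred.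
Proof. by move=> fh; apply/asboolP; apply: (in_sum_comp endr_comp_zmod fh). Qed.

Lemma endr_linear f : f \in endr_pred -> linear f.
Proof.
move=> /asboolP[s [e [_ eC ->]]] a u v; rewrite fct_sumE scaler_sumr -big_split.
by apply: eq_bigr => h _; have /asboolP[-> _] := eC h.
Qed.

Record endr := Endr { endr_fun :> W -> W; endr_funP : endr_fun \in endr_pred }.
HB.instance Definition _ := [isSub for endr_fun].
HB.instance Definition _ := [Choice of endr by <:].
HB.instance Definition _ :=
  GRing.SubChoice_isSubZmodule.Build (W -> W) endr_pred endr endr_zmod.

Lemma endr_ext (f f' : endr) : f =1 f' -> f = f'.
Proof. by move=> ff'; apply: val_inj; apply: funext. Qed.

Lemma endrD (f f' : endr) w : (f + f') w = f w + f' w.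
Proof. by rewrite -[LHS]/(val (f + f') w) raddfD. Qed.

Fact endr_is_linear (f : endr) : linear f.
Proof. exact/endr_linear/endr_funP. Qed.
HB.instance Definition _ (f : endr) := GRing.isLinear.Build A W W *:%R f
  (endr_is_linear f).

Lemma endr_comp_comp g h f f' :
  f \in endr_comp g -> f' \in endr_comp h -> f' \o f \in endr_comp (g * h)%g.
Proof.
move=> /asboolP[fl fg] /asboolP[fl' fg']; apply/asboolP; split.
  by move=> a u v /=; rewrite fl fl'.
by move=> k w wk; rewrite mulgA; apply/fg'/fg.
Qed.

Fact endr_mul_subproof (f f' : endr) : f' \o f \in endr_pred.
Proof.
have /asboolP[s [e [_ eC E]]] := endr_funP f.
have /asboolP[s' [e' [_ eC' E']]] := endr_funP f'.
have -> : f' \o f = \sum_(g <- s) \sum_(h <- s') (e' h \o e g).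
  apply: funext => w /=; rewrite fct_sumE.
  transitivity (\sum_(g <- s) f' (e g w)); first by rewrite E fct_sumE raddf_sum.
  by apply: eq_bigr => g _; rewrite E' !fct_sumE.
apply/asboolP; do 2 !apply: (in_sum_sum endr_comp_zmod) => ? _.
exact: (in_sum_comp endr_comp_zmod (endr_comp_comp (eC _) (eC' _))).
Qed.
(* Endomorphisms act from the right: the product f f' is first f, then f'. *)
Definition endr_mul (f f' : endr) : endr := Endr (endr_mul_subproof f f').

Fact endr_scal_subproof c : (fun w : W => galg_scal A c *: w) \in endr_comp 1%g.
Proof.
apply/asboolP; split=> [a u v|g w wg].
  by rewrite scalerDr !scalerA galg_scalC.
by rewrite mulg1 -[g]mul1g; apply: mcompZ => //; apply: base_valP (base_scal A c).
Qed.
Definition endr_scal (c : F) : endr := Endr (endr_comp_pred (endr_scal_subproof c)).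

Fact endr_mulA : associative endr_mul.
Proof. by move=> f f' f''; apply: endr_ext. Qed.
Fact endr_mul1l : left_id (endr_scal 1) endr_mul.
Proof. by move=> f; apply: endr_ext => w /=; rewrite rmorph1 scale1r. Qed.
Fact endr_mul1r : right_id (endr_scal 1) endr_mul.
Proof. by move=> f; apply: endr_ext => w /=; rewrite rmorph1 scale1r. Qed.
Fact endr_mulDl : left_distributive endr_mul +%R.
Proof.
move=> f f' f''; apply: endr_ext => w.
by rewrite endrD -[LHS]/(f'' ((f + f') w)) endrD raddfD.
Qed.
Fact endr_mulDr : right_distributive endr_mul +%R.
Proof.
move=> f f' f''; apply: endr_ext => w.
by rewrite endrD -[LHS]/((f' + f'') (f w)) endrD.
Qed.
HB.instance Definition _ := GRing.Zmodule_isPzRing.Build endr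
  endr_mulA endr_mul1l endr_mul1r endr_mulDl endr_mulDr.

Fact endr_scal_additive : zmod_morphism endr_scal.
Proof.
move=> c d; apply: val_inj; rewrite raddfB; apply: funext => w /=.
by rewrite rmorphB scalerBl.
Qed.
Fact endr_scal_multiplicative : monoid_morphism endr_scal.
Proof.
split=> // c d; apply: endr_ext => w /=.
by rewrite scalerA -rmorphM mulrC.
Qed.
HB.instance Definition _ := GRing.isZmodMorphism.Build F endr endr_scal endr_scal_additive.
HB.instance Definition _ := GRing.isMonoidMorphism.Build F endr endr_scal endr_scal_multiplicative.

Fact endr_scalC c (f : endr) : endr_scal c * f = f * endr_scal c.
Proof. by apply: endr_ext => w /=; rewrite linearZ. Qed.

Definition endr_gcomp (h : G) : {pred endr} := fun f => endr_fun f \in endr_comp h.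

Fact endr_gcomp_zmod h : zmod_closed (endr_gcomp h).
Proof.
have [C0 CB] := endr_comp_zmod h.
split=> [|f f' fh fh']; first exact: C0.
by have := CB _ _ fh fh'; rewrite -(raddfB (val : endr -> (W -> W))).
Qed.

Fact endr_gcompM g h f f' :
  f \in endr_gcomp g -> f' \in endr_gcomp h -> f * f' \in endr_gcomp (g * h)%g.
Proof. exact: endr_comp_comp. Qed.

Fact endr_gcomp_scal h c f : f \in endr_gcomp h -> endr_scal c * f \in endr_gcomp h.
Proof.
by move=> fh; rewrite -[h]mul1g; apply: endr_gcompM => //; apply: endr_scal_subproof.
Qed.

Fact endr_direct : direct_decomposition endr_gcomp.
Proof.
split=> [[f fG]|s f us fC sf h hs].
  have /asboolP[s [e [us eC E]]] := fG.
  exists s, (fun h => Endr (endr_comp_pred (eC h))); split=> //.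
  by apply: val_inj; rewrite raddf_sum.
have hom g w : w \in mcomp W g -> f h w = 0.
  move=> wg; have := congr1 (fun e => mproj (g * h)%g (val e w)) sf.
  rewrite !raddf_sum fct_sumE raddf_sum !raddf0 (bigD1_seq h) //= big1.
    have /asboolP[_ fd] := fC h.
    by rewrite addr0 (mproj_id _ (fd _ _ wg)) eqxx.
  move=> k kh; have /asboolP[_ fd] := fC k.
  by rewrite (mproj_id _ (fd _ _ wg)) (inj_eq (mulgI g)) (negbTE kh).
apply: endr_ext => w; have [t [_ _ ->]] := mproj_sum w.
rewrite raddf_sum big1 // => g _; exact: (hom g _ (mproj_mem g w)).
Qed.

Definition end_r : gradedAlgebra F G := GradedAlgebra
  endr_scalC endr_gcomp_zmod endr_gcomp_scal endr_direct endr_gcompM.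
End RightEndomorphisms.

Section Cocycles.
Variables (F : fieldType) (G : groupType).

Definition Z2_pred : pred (G -> G -> F) := fun f =>
  `[< (forall g h, f g h != 0) /\
      (forall g h k, f g h * f (g * h)%g k = f h k * f g (h * k)%g) >].

Record Z2 := MkZ2 { Z2_fun :> G -> G -> F; Z2P : Z2_pred Z2_fun }.
HB.instance Definition _ := [isSub for Z2_fun].
HB.instance Definition _ := [Choice of Z2 by <:].

Lemma Z2_neq0 (a : Z2) g h : a g h != 0.
Proof. by have /asboolP[-> _] := Z2P a. Qed.
Lemma Z2_cocycle (a : Z2) g h k : a g h * a (g * h)%g k = a h k * a g (h * k)%g.
Proof. by have /asboolP[_ ->] := Z2P a. Qed.
Lemma Z2_ext (a b : Z2) : (forall g h, a g h = b g h) -> a = b.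
Proof. by move=> ab; apply: val_inj; apply/funext=> g; apply/funext=> h. Qed.

Fact Z2_one_subproof : Z2_pred (fun _ _ => 1).
Proof. by apply/asboolP; split=> // g h; apply: oner_neq0. Qed.
Fact Z2_inv_subproof (a : Z2) : Z2_pred (fun g h => (a g h)^-1).
Proof.
apply/asboolP; split=> [g h|g h k]; first by rewrite invr_eq0 Z2_neq0.
by rewrite -!invfM Z2_cocycle.
Qed.
Fact Z2_mul_subproof (a b : Z2) : Z2_pred (fun g h => a g h * b g h).
Proof.
apply/asboolP; split=> [g h|g h k]; first by rewrite mulf_neq0 ?Z2_neq0.
by rewrite mulrACA !Z2_cocycle mulrACA.
Qed.
Definition Z2_one := MkZ2 Z2_one_subproof.
Definition Z2_inv a := MkZ2 (Z2_inv_subproof a).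
Definition Z2_mul a b := MkZ2 (Z2_mul_subproof a b).
Fact Z2_mulA : associative Z2_mul.
Proof. by move=> a b c; apply: Z2_ext => g h /=; rewrite mulrA. Qed.
Fact Z2_mul1 : left_id Z2_one Z2_mul.
Proof. by move=> a; apply: Z2_ext => g h /=; rewrite mul1r. Qed.
Fact Z2_mulr1 : right_id Z2_one Z2_mul.
Proof. by move=> a; apply: Z2_ext => g h /=; rewrite mulr1. Qed.
Fact Z2_mulV : left_inverse Z2_one Z2_inv Z2_mul.
Proof. by move=> a; apply: Z2_ext => g h /=; rewrite mulVf ?Z2_neq0. Qed.
Fact Z2_mulrV : right_inverse Z2_one Z2_inv Z2_mul.
Proof. by move=> a; apply: Z2_ext => g h /=; rewrite mulfV ?Z2_neq0. Qed.
HB.instance Definition _ :=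
  isGroup.Build Z2 Z2_mulA Z2_mul1 Z2_mulr1 Z2_mulV Z2_mulrV.

Definition cohomologous : rel Z2 := fun a b => `[< exists2 l : G -> F,
  (forall g, l g != 0) &
  (forall g h, a g h = b g h * (l g * l h / l (g * h)%g)) >].

Fact cohomologous_equiv : equiv_class_of cohomologous.
Proof.
have sym a b : cohomologous a b -> cohomologous b a.
  move=> /asboolP[l l0 E]; apply/asboolP; exists (fun g => (l g)^-1).
    by move=> g; rewrite invr_eq0.
  move=> g h; rewrite E -mulrA -[LHS]mulr1; congr (_ * _).
  by rewrite -!invfM mulfV // !mulf_neq0 ?invr_eq0.
split=> [a|a b|b a c].
- apply/asboolP; exists (fun=> 1) => [g|g h]; first exact: oner_neq0.
  by rewrite invr1 !mulr1.
- by apply/idP/idP=> /sym.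
- move=> /asboolP[l l0 E] /asboolP[m m0 E']; apply/asboolP.
  exists (fun g => l g * m g) => [g|g h]; first by rewrite mulf_neq0.
  rewrite E E' -mulrA; congr (_ * _).
  by rewrite mulrC mulrACA -invfM; congr (_ / _); rewrite mulrACA.
Qed.
Canonical cohomologous_equiv_rel := EquivRelPack cohomologous_equiv.
Canonical cohomologous_encModRel := defaultEncModRel cohomologous.

Definition H2 := {eq_quot cohomologous}.
HB.instance Definition _ := Choice.on H2.
HB.instance Definition _ := EqQuotient.on H2.
Definition cohom_class (a : Z2) : H2 := \pi_H2 a.

Lemma cohom_classP a b : reflect (cohom_class a = cohom_class b) (cohomologous a b).
Proof. exact: eqmodP. Qed.

Lemma cohomologous_mul a b c d : cohomologous a b -> cohomologous c d ->
  cohomologous (a * c)%g (b * d)%g.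
Proof.
move=> /asboolP[l l0 E] /asboolP[m m0 E']; apply/asboolP.
exists (fun g => l g * m g) => [g|g h]; first by rewrite mulf_neq0.
rewrite -[LHS]/(a g h * c g h) -[(b * d)%g g h]/(b g h * d g h) E E' mulrACA.
by congr (_ * _); rewrite mulrACA -invfM; congr (_ / _); rewrite mulrACA.
Qed.

Lemma cohomologous_inv a b : cohomologous a b -> cohomologous a^-1%g b^-1%g.
Proof.
move=> /asboolP[l l0 E]; apply/asboolP; exists (fun g => (l g)^-1) => [g|g h].
  by rewrite invr_eq0.
by rewrite -[LHS]/(a g h)^-1 -[b^-1%g g h]/(b g h)^-1 E -!invfM.
Qed.

Definition H2_one : H2 := cohom_class 1%g.
Definition H2_inv (x : H2) : H2 := cohom_class (repr x)^-1%g.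
Definition H2_mul (x y : H2) : H2 := cohom_class (repr x * repr y)%g.

Lemma cohom_classW (P : H2 -> Prop) : (forall a, P (cohom_class a)) -> forall x, P x.
Proof. by move=> Pa x; rewrite -[x]reprK; apply: Pa. Qed.
Lemma cohom_class_repr a : cohomologous (repr (cohom_class a)) a.
Proof. by apply/cohom_classP; rewrite /cohom_class reprK. Qed.
Lemma cohom_classM a b :
  H2_mul (cohom_class a) (cohom_class b) = cohom_class (a * b)%g.
Proof. by apply/cohom_classP/cohomologous_mul; apply: cohom_class_repr. Qed.
Lemma cohom_classV a : H2_inv (cohom_class a) = cohom_class a^-1%g.
Proof. by apply/cohom_classP/cohomologous_inv; apply: cohom_class_repr. Qed.

Fact H2_mulA : associative H2_mul.
Proof.
elim/cohom_classW=> a; elim/cohom_classW=> b; elim/cohom_classW=> c.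
by rewrite !cohom_classM mulgA.
Qed.
Fact H2_mul1 : left_id H2_one H2_mul.
Proof. by elim/cohom_classW=> a; rewrite cohom_classM mul1g. Qed.
Fact H2_mulr1 : right_id H2_one H2_mul.
Proof. by elim/cohom_classW=> a; rewrite cohom_classM mulg1. Qed.
Fact H2_mulV : left_inverse H2_one H2_inv H2_mul.
Proof. by elim/cohom_classW=> a; rewrite cohom_classV cohom_classM mulVg. Qed.
Fact H2_mulrV : right_inverse H2_one H2_inv H2_mul.
Proof. by elim/cohom_classW=> a; rewrite cohom_classV cohom_classM mulgV. Qed.
HB.instance Definition _ :=
  isGroup.Build H2 H2_mulA H2_mul1 H2_mulr1 H2_mulV H2_mulrV.
End Cocycles.

Section TwistedGroupAlgebra.
Variables (F : fieldType) (G : groupType) (a : Z2 F G).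

Definition twalg := {malg F[G]}.
HB.instance Definition _ := GRing.Zmodule.on twalg.
Local Notation U c g := (mkmalgU g c : {malg F[G]}).

Definition tw_mul (x y : {malg F[G]}) : {malg F[G]} :=
  \sum_(g <- msupp x) \sum_(h <- msupp y)
    U (mcoeff g x * mcoeff h y * a g h) (g * h)%g.

Lemma tw_mulEw (d e : {fset G}) x y :
  {subset msupp x <= d} -> {subset msupp y <= e} ->
  tw_mul x y = \sum_(g <- d) \sum_(h <- e)
    U (mcoeff g x * mcoeff h y * a g h) (g * h)%g.
Proof.
move=> xd ye; rewrite /tw_mul.
rewrite (@sum_extend _ {malg F[G]} (msupp x) d) ?fset_uniq //.
  apply: eq_bigr => g _.
  rewrite (@sum_extend _ {malg F[G]} (msupp y) e) ?fset_uniq // => h.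
  by move=> /mcoeff_outdom ->; rewrite mulr0 mul0r monalgU0.
by move=> g /mcoeff_outdom ->; rewrite big1 // => h _; rewrite !mul0r monalgU0.
Qed.

Fact tw_mulDl : left_distributive tw_mul +%R.
Proof.
move=> x x' y; pose d := (msupp (x + x')%R `|` msupp x `|` msupp x')%fset.
have sub (z : {malg F[G]}) : {subset msupp z <= d} ->
    tw_mul z y = \sum_(g <- d) \sum_(h <- msupp y)
      U (mcoeff g z * mcoeff h y * a g h) (g * h)%g.
  by move=> zd; apply: tw_mulEw.
rewrite !sub; try by move=> g gz; rewrite !in_fsetU gz ?orbT.
rewrite -big_split; apply: eq_bigr => g _ /=; rewrite -big_split.
by apply: eq_bigr => h _ /=; rewrite mcoeffD !mulrDl monalgUD.
Qed.

Fact tw_mulDr : right_distributive tw_mul +%R.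
Proof.
move=> x y y'; pose d := (msupp (y + y')%R `|` msupp y `|` msupp y')%fset.
have sub (z : {malg F[G]}) : {subset msupp z <= d} ->
    tw_mul x z = \sum_(g <- msupp x) \sum_(h <- d)
      U (mcoeff g x * mcoeff h z * a g h) (g * h)%g.
  by move=> zd; apply: tw_mulEw.
rewrite !sub; try by move=> g gz; rewrite !in_fsetU gz ?orbT.
rewrite -big_split; apply: eq_bigr => g _ /=; rewrite -big_split.
by apply: eq_bigr => h _ /=; rewrite mcoeffD mulrDr mulrDl monalgUD.
Qed.

Fact tw_mul0l x : tw_mul 0 x = 0.
Proof. by apply: (addrI (tw_mul 0 x)); rewrite -tw_mulDl !addr0. Qed.
Fact tw_mul0r x : tw_mul x 0 = 0.
Proof. by apply: (addrI (tw_mul x 0)); rewrite -tw_mulDr !addr0. Qed.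

Lemma tw_mulU c g d h : tw_mul (U c g) (U d h) = U (c * d * a g h) (g * h)%g.
Proof.
rewrite (@tw_mulEw [fset g]%fset [fset h]%fset) ?big_seq_fset1 ?mcoeffUU //.
  by apply/fsubsetP/msuppU_le.
by apply/fsubsetP/msuppU_le.
Qed.

Lemma tw_gen (P : {malg F[G]} -> Prop) :
  P 0 -> (forall x y, P x -> P y -> P (x + y)) -> (forall c g, P (U c g)) ->
  forall x, P x.
Proof. by move=> P0 PD PU x; rewrite [x]monalgE; apply: big_ind. Qed.

Lemma Z2_1l g : a 1%g g = a 1%g 1%g.
Proof.
have := Z2_cocycle a 1%g 1%g g; rewrite !mul1g => /(mulIf (Z2_neq0 a _ _)).
exact: esym.
Qed.
Lemma Z2_1r g : a g 1%g = a 1%g 1%g.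
Proof.
by have := Z2_cocycle a g 1%g 1%g; rewrite !mulg1 => /(mulIf (Z2_neq0 a _ _)).
Qed.

(* Cocycles are not assumed normalized, so the unit of the twisted group algebra
   is (a 1 1)^-1 v_1 rather than v_1. *)
Definition tw_scal (c : F) : twalg := U (c / a 1%g 1%g) 1%g.

Fact tw_mulA : associative tw_mul.
Proof.
elim/tw_gen=> [y z|x x' IH IH' y z|c g]; first by rewrite !tw_mul0l.
  by rewrite !tw_mulDl IH IH'.
elim/tw_gen=> [z|y y' IH IH' z|d h]; first by rewrite !(tw_mul0l, tw_mul0r).
  by rewrite !(tw_mulDl, tw_mulDr) IH IH'.
elim/tw_gen=> [|z z' IH IH'|e k]; first by rewrite !tw_mul0r.
  by rewrite !tw_mulDr IH IH'.
rewrite !tw_mulU mulgA; congr mkmalgU.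
by rewrite !mulrA [in RHS](mulrAC (c * d)) -[LHS]mulrA -[RHS]mulrA Z2_cocycle.
Qed.
Fact tw_mul1l : left_id (tw_scal 1) tw_mul.
Proof.
elim/tw_gen=> [|x y IH IH'|c g]; first by rewrite tw_mul0r.
  by rewrite tw_mulDr IH IH'.
by rewrite tw_mulU mul1g Z2_1l mul1r mulrAC mulVf ?mul1r // Z2_neq0.
Qed.
Fact tw_mul1r : right_id (tw_scal 1) tw_mul.
Proof.
elim/tw_gen=> [|x y IH IH'|c g]; first by rewrite tw_mul0l.
  by rewrite tw_mulDl IH IH'.
by rewrite tw_mulU mulg1 Z2_1r mul1r mulfVK // Z2_neq0.
Qed.
HB.instance Definition _ := GRing.Zmodule_isPzRing.Build twalg
  tw_mulA tw_mul1l tw_mul1r tw_mulDl tw_mulDr.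

Fact tw_scal_additive : zmod_morphism tw_scal.
Proof. by move=> c d; rewrite /tw_scal mulrBl raddfB. Qed.
Fact tw_scal_multiplicative : monoid_morphism tw_scal.
Proof.
split=> // c d; rewrite -[RHS]/(tw_mul _ _) tw_mulU mulg1; congr mkmalgU.
by rewrite mulrAC [in RHS]mulrA mulfVK ?Z2_neq0 // mulrAC.
Qed.
HB.instance Definition _ := GRing.isZmodMorphism.Build F twalg tw_scal tw_scal_additive.
HB.instance Definition _ :=
  GRing.isMonoidMorphism.Build F twalg tw_scal tw_scal_multiplicative.

Lemma tw_scalU c d g : tw_mul (tw_scal c) (U d g) = U (c * d) g.
Proof. by rewrite tw_mulU mul1g Z2_1l mulrAC mulfVK ?Z2_neq0. Qed.

Fact tw_scalC c (x : twalg) : tw_scal c * x = x * tw_scal c.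
Proof.
rewrite -[LHS]/(tw_mul _ _) -[RHS]/(tw_mul _ _).
elim/tw_gen: x => [|x y IH IH'|d g]; first by rewrite tw_mul0l tw_mul0r.
  by rewrite tw_mulDr tw_mulDl IH IH'.
by rewrite tw_scalU tw_mulU mulg1 Z2_1r mulrA mulfVK ?Z2_neq0 // mulrC.
Qed.

Definition tw_comp (g : G) : {pred twalg} := fun x => `[< exists c : F, x = U c g >].

Fact tw_comp_zmod g : zmod_closed (tw_comp g).
Proof.
split; first by apply/asboolP; exists 0; rewrite monalgU0.
move=> _ _ /asboolP[c ->] /asboolP[d ->]; apply/asboolP; exists (c - d).
by rewrite monalgUB.
Qed.

Fact tw_comp_scal g c (x : twalg) : x \in tw_comp g -> tw_scal c * x \in tw_comp g.
Proof.
by move=> /asboolP[d ->]; apply/asboolP; exists (c * d); apply: tw_scalU.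
Qed.

Fact tw_direct : direct_decomposition tw_comp.
Proof.
split=> [x|s f us fC sf g gs].
  exists (msupp x), (fun g => U (mcoeff g x) g); split; first exact: fset_uniq.
    by move=> g; apply/asboolP; exists (mcoeff g x).
  exact: monalgE.
have /asboolP[c fg] := fC g; have := congr1 (mcoeff g) sf.
rewrite raddf_sum (bigD1_seq g) //= big1 => [|h /negbTE hg].
  by rewrite mcoeff0 addr0 fg mcoeffUU => ->; rewrite monalgU0.
by have /asboolP[d ->] := fC h; rewrite mcoeffU hg.
Qed.

Fact tw_compM g h (x y : twalg) :
  x \in tw_comp g -> y \in tw_comp h -> x * y \in tw_comp (g * h)%g.
Proof.
move=> /asboolP[c ->] /asboolP[d ->]; apply/asboolP.
by exists (c * d * a g h); apply: tw_mulU.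
Qed.

Definition twisted : gradedAlgebra F G := GradedAlgebra
  tw_scalC tw_comp_zmod tw_comp_scal tw_direct tw_compM.
End TwistedGroupAlgebra.

Section Restriction.

(* Up to transport of structure along f: M carries an S-module structure from which
   its R-module structure is obtained through phi. *)
Definition restricted_along (R S : pzRingType) (phi : {rmorphism R -> S})
    (M : lmodType R) : Prop :=
  exists (N : lmodType S) (f : {additive M -> N}),
    bijective f /\ forall (x : R) (m : M), f (x *: m) = phi x *: f m.

Variables (F : fieldType) (G : groupType) (A : gradedAlgebra F G).

Definition twist (a : Z2 F G) : gradedAlgebra F G := gprod (twisted a) A.

Definition base_incl : {rmorphism base A -> A} := val : base A -> A.

(* x |-> 1 (x) x, the identification of the base algebra of A with that of its
   twist, here as a map into the whole twist. *)
Definition twist_base (a : Z2 F G) (x : base A) : twist a :=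
  Gpr (gpr_pure_subproof (gcomp1 (twisted a)) (base_valP x)).

Fact twist_base_additive a : zmod_morphism (twist_base a).
Proof.
move=> x y; apply: val_inj; rewrite raddfB /=.
by rewrite /talg_pure tpureDr tpureNr.
Qed.
Fact twist_base_multiplicative a : monoid_morphism (twist_base a).
Proof.
split=> [|x y]; apply: val_inj; first by [].
by rewrite rmorphM /= talg_pureM mul1r.
Qed.
HB.instance Definition _ a := GRing.isZmodMorphism.Build (base A) (twist a)
  (twist_base a) (twist_base_additive a).
HB.instance Definition _ a := GRing.isMonoidMorphism.Build (base A) (twist a)
  (twist_base a) (twist_base_multiplicative a).

Definition restricted_from (M : lmodType (base A)) : Prop :=
  restricted_along base_incl M.
Definition restricted_from_twist (a : Z2 F G) (M : lmodType (base A)) : Prop :=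
  restricted_along (twist_base a) M.
End Restriction.

Section AbsolutelySimple.
Variables (F : fieldType) (G : groupType) (A : gradedAlgebra F G).
Implicit Types M : lmodType (base A).

Definition simple_module (R : pzRingType) (M : lmodType R) : Prop :=
  (exists m : M, m != 0) /\
  forall N : {pred M}, submod_closed N ->
    (forall m, m \in N -> m = 0) \/ (forall m, m \in N).

Definition abs_simple M : Prop :=
  simple_module M /\
  forall f : {linear M -> M}, exists c : F, forall m, f m = base_scal A c *: m.

Definition graded_induced M : gradedModule A := assoc_graded (induced M).

Definition invariant M : Prop :=
  forall g : G,
    gradedMod_isomorphic (graded_induced M) (suspension g (graded_induced M)).

Definition iso_class M : lmodType (base A) -> Prop :=
  fun N => exists f : {linear M -> N}, bijective f.

(* Isomorphism classes, as sets of modules. *)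
Record Irr := MkIrr {
  Irr_class :> lmodType (base A) -> Prop;
  Irr_classP : exists2 M, abs_simple M & Irr_class = iso_class M
}.

Record Irr_inv := MkIrr_inv {
  Irr_inv_class :> Irr;
  Irr_invP : exists2 M, Irr_inv_class M & invariant M
}.

(* As every cohomology class has a representative, this equivalence states both
   the existence and the uniqueness of the class, hence determines omega. *)
Definition is_obstruction_map (omega : Irr_inv -> H2 F G) : Prop :=
  forall (X : Irr_inv) M, X M -> forall w : Z2 F G,
    cohom_class w = omega X <->
    gradedAlg_isomorphic (end_r (graded_induced M)) (twisted w).
End AbsolutelySimple.

(* Main.v *)
Require Import Defs.
From HB Require Import structures.
From mathcomp Require Import all_boot all_algebra.
From mathcomp Require Import boolp functions monalg.

(** Write V for the graded module associated with M, and regard M as its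
component of degree 1, which generates V. A graded isomorphism from V to its
suspension by g is an invertible endomorphism of V of degree g. An endomorphism
of degree 1 is determined by its restriction to M, hence is a scalar because
End(M) = F. Dividing by the chosen invertible u_g, every endomorphism of degree
g is therefore a multiple of u_g, so u_g u_h = w(g,h) u_{gh} for some nonzero
scalars w(g,h), and associativity says that w is a cocycle
([twist_basis_exists]). Another choice of the u_g changes w by a coboundary
([twist_basis_cohom]), so the class of w is an invariant of the graded algebra
of endomorphisms of V, and the obstruction map sends M to it.

A module over the twist of A by alpha that extends M is the same as a family of
operators m |-> (v_g (x) a) m, for a in A_g, whose composites obey A up to the
factor alpha(g,h): see [twisted_action]. If the u_g multiply with the cocycle w,
then a m lies in the component V_g and u_g maps M onto V_g bijectively, so one
may put (v_g (x) a) m := u_g^-1 (a m). Undoing u_g and then u_h is undoing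
w(h,g) u_{hg}; hence this is a twisted action for w^-1
([basis_twisted_action]), which is the first implication.

For the converse, M now carries two twisted actions: the one just built, S, for
w^-1, and the given one, T, for alpha. When A is strongly graded, write
1 = sum_i x_i y_i with x_i in A_g and y_i in A_{g^-1}. The operator
theta(m) = sum_i T_g(x_i) S_{g^-1}(y_i) m commutes with the base algebra, so it
is a scalar, and theta S_g(a) is a nonzero multiple of T_g(a). Thus T_g and S_g
are proportional for each g, and comparing the composition rules shows that the
two cocycles differ by the coboundary of the ratios ([twisted_action_cohom]). *)

Set Implicit Arguments.
Unset Strict Implicit.
Unset Printing Implicit Defensive.

Import GRing.Theory.
Local Open Scope ring_scope.

(** * Direct sums *)

Section DirectSums.
Variables (I : choiceType) (V : zmodType) (C : I -> {pred V}).
Hypotheses (Cz : forall i, zmod_closed (C i)) (Cd : direct_decomposition C).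

Lemma direct_ind (P : V -> Prop) :
  P 0 -> (forall x y, P x -> P y -> P (x + y)) ->
  (forall i x, x \in C i -> P x) -> forall x, P x.
Proof.
move=> P0 PD PC x; have [s [f [_ fC ->]]] := Cd.1 x.
by apply: big_ind => // i _; apply: PC (fC i).
Qed.

(** An additive map out of a direct sum may be prescribed on each component
separately. Morphisms out of a twisted group algebra and module structures over a
graded algebra both arise this way. *)
Lemma direct_extension (U : zmodType) (T : I -> V -> U) :
  (forall i, {in C i &, {morph T i : x y / x - y}}) ->
  exists f : {additive V -> U}, forall i x, x \in C i -> f x = T i x.
Proof.
move=> TB; pose d := dproj Cz Cd.
have T0 i : T i 0 = 0.
  by have [C0 _] := Cz i; rewrite -[in LHS](subrr 0) TB // subrr.
pose supp x := sval (cid (dproj_sum Cz Cd x)).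
have suppP x : uniq (supp x) /\ forall i, i \notin supp x -> d i x = 0.
  by rewrite /supp; case: cid => s [].
(* The supports are arbitrary choices, so values at different elements are
   compared over a common larger list of indices. *)
pose f x := \sum_(i <- supp x) T i (d i x).
have fE x s : uniq s -> {subset supp x <= s} -> f x = \sum_(i <- s) T i (d i x).
  move=> us xs; have [ux x0] := suppP x.
  by apply: (sum_extend ux us xs) => i /x0 ->.
have fB : zmod_morphism f.
  move=> x y; pose s := undup (supp (x - y) ++ supp x ++ supp y).
  have us : uniq s by apply: undup_uniq.
  rewrite !(fE _ s) => // [|i|i|i]; last first.
  - by rewrite mem_undup !mem_cat => ->.
  - by rewrite mem_undup !mem_cat => ->; rewrite orbT.
  - by rewrite mem_undup !mem_cat => ->; rewrite !orbT.
  rewrite -sumrB; apply: eq_bigr => i _.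
  by rewrite /d raddfB TB // dproj_mem.
pose fM := GRing.isZmodMorphism.Build V U f fB.
pose fA : {additive V -> U} := HB.pack f fM.
exists fA => i x xC; rewrite -[LHS]/(f x).
rewrite (fE _ (undup (i :: supp x))) ?undup_uniq // => [|j]; last first.
  by rewrite mem_undup inE orbC => ->.
rewrite (bigD1_seq i) ?undup_uniq ?mem_undup ?mem_head //=.
rewrite /d (dproj_id Cz Cd _ xC) eqxx big1 ?addr0 // => j /negbTE ji.
by rewrite (dproj_id Cz Cd _ xC) eq_sym ji T0.
Qed.
End DirectSums.

(** The components of [f x] are the images of those of [x], and [f] is injective,
so [x] equals its own component of degree [i]. Hence the inverse of a graded
bijection is graded. *)
Lemma graded_bij_mem (I : choiceType) (V V' : zmodType)
    (C : I -> {pred V}) (C' : I -> {pred V'})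
    (Cz : forall i, zmod_closed (C i)) (Cd : direct_decomposition C)
    (Cz' : forall i, zmod_closed (C' i)) (Cd' : direct_decomposition C')
    (f : {additive V -> V'}) :
  injective f -> (forall i x, x \in C i -> f x \in C' i) ->
  forall i x, f x \in C' i -> x \in C i.
Proof.
move=> fI fC i x fxC; suff <- : dproj Cz Cd i x = x by apply: dproj_mem.
apply: fI; rewrite -(dproj_morph Cz Cd Cz' Cd' (sigma := id)) //.
by rewrite (dproj_id Cz' Cd' _ fxC) eqxx.
Qed.

(** * Twisted group algebras recognized by a basis *)

Section TwistBasis.
Variables (F : fieldType) (G : groupType).
Implicit Types (B : gradedAlgebra F G) (w : Z2 F G).

(** The images of the [v_g] under a graded isomorphism from the twisted group
algebra. Working with such a family avoids composing and inverting isomorphisms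
of graded algebras. *)
Definition twist_basis B w (u : G -> B) : Prop :=
  [/\ forall g, u g \in gcomp B g, forall g, u g != 0,
      forall g x, x \in gcomp B g -> exists c, x = galg_scal B c * u g
    & forall g h, u g * u h = galg_scal B (w g h) * u (g * h)%g].

Lemma scal_eq0 B c (x : B) : galg_scal B c * x = 0 -> x != 0 -> c = 0.
Proof.
move=> cx x0; apply/eqP; apply: contraT => c0; case/eqP: x0.
by rewrite -[x]mul1r -(rmorph1 (galg_scal B)) -(mulVf c0) rmorphM -mulrA cx mulr0.
Qed.

Lemma scal_inj B c d (x : B) :
  x != 0 -> galg_scal B c * x = galg_scal B d * x -> c = d.
Proof.
move=> x0 /eqP; rewrite -subr_eq0 -mulrBl -rmorphB => /eqP/scal_eq0/(_ x0)/eqP.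
by rewrite subr_eq0 => /eqP.
Qed.

Lemma scalACA B c d (x y : B) :
  galg_scal B c * x * (galg_scal B d * y) = galg_scal B (c * d) * (x * y).
Proof. by rewrite rmorphM -!mulrA (mulrA x) -galg_scalC -mulrA. Qed.

(** Cocycles are not normalized, so [u 1] is a scalar but need not be [1]. *)
Lemma twist_basis1 B w (u : G -> B) : twist_basis w u ->
  u 1%g = galg_scal B (w 1%g 1%g).
Proof.
case=> uB u0 uS uM; have [c c1] := uS _ _ (gcomp1 B).
have [d ud] : exists d, u 1%g = galg_scal B d.
  have c0 : c != 0.
    apply: contraNneq (u0 1%g) => c0.
    by rewrite -[u 1%g]mul1r c1 c0 rmorph0 !mul0r.
  exists c^-1; rewrite -[RHS]mulr1 c1 mulrA -rmorphM mulVf // rmorph1 mul1r //.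
have := uM 1%g 1%g; rewrite mulg1 {1}ud => /(scal_inj (u0 _)) <-; exact: ud.
Qed.

(** Each component is a line, so [u g] and [u' g] are proportional; the ratios
form the cochain relating the two cocycles. *)
Lemma twist_basis_cohom B w w' (u u' : G -> B) :
  twist_basis w u -> twist_basis w' u' -> cohomologous w w'.
Proof.
move=> [uB u0 uS uM] [uB' u0' uS' uM'].
have [l lE] := choice (fun g => uS' g (u g) (uB g)).
have l0 g : l g != 0.
  by apply: contraNneq (u0 g) => lg; rewrite lE lg rmorph0 mul0r.
apply/asboolP; exists l => // g h; have := uM g h.
rewrite !lE scalACA uM' !mulrA -!rmorphM => /(scal_inj (u0' _)) E.
by apply: (mulIf (l0 (g * h)%g)); rewrite -E mulfVK // -[RHS]mulrA mulrC.
Qed.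

Lemma twist_basis_rescale B w w' (u : G -> B) :
  twist_basis w u -> cohomologous w' w -> exists u' : G -> B, twist_basis w' u'.
Proof.
move=> [uB u0 uS uM] /asboolP[l l0 E].
exists (fun g => galg_scal B (l g) * u g); split=> [g|g|g x|g h].
- exact: gcomp_scal.
- by apply: contra_neq (l0 g) => /scal_eq0; apply.
- move=> /uS[c ->]; exists (c / l g).
  by rewrite mulrA -rmorphM mulfVK.
- rewrite scalACA uM !mulrA -!rmorphM E; congr (galg_scal B _ * _).
  by rewrite mulrA mulfVK // mulrC.
Qed.

Lemma iso_twist_basis B w : gradedAlg_isomorphic B (twisted w) ->
  exists u : G -> B, twist_basis w u.
Proof.
move=> [f [[f' fK fK'] fs fd]]; pose v g : twisted w := mkmalgU g 1.
have vS c g : galg_scal (twisted w) c * v g = mkmalgU g c.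
  by rewrite -[LHS]/(tw_mul _ _ _) tw_scalU mulr1.
have fI := can_inj fK.
exists (fun g => f' (v g)); split=> [g|g|g x xg|g h].
- apply: (graded_bij_mem (gcomp_zmod B) (gcomp_direct B) (gcomp_zmod (twisted w))
    (gcomp_direct (twisted w)) fI fd); rewrite -[X in X \in _]/(f (f' (v g))) fK'.
  by apply/asboolP; exists 1.
- rewrite -(inj_eq fI) fK' rmorph0; apply/eqP => /(congr1 (mcoeff g)).
  by rewrite mcoeffUU mcoeff0 => /eqP; rewrite oner_eq0.
- have /asboolP[c fx] := fd _ _ xg; exists c.
  by apply: fI; rewrite rmorphM fs fK' fx vS.
- apply: fI; rewrite !rmorphM /= fs !fK' vS.
  by rewrite -[LHS]/(tw_mul _ _ _) tw_mulU !mul1r.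
Qed.

Lemma twist_basis_iso B w (u : G -> B) : twist_basis w u ->
  gradedAlg_isomorphic B (twisted w).
Proof.
move=> bu; have u1 := twist_basis1 bu; have [uB u0 uS uM] := bu.
pose Tw := twisted w; pose s := galg_scal B.
have [p pE] : exists p : {additive Tw -> B}, forall c g,
    p (mkmalgU g c : {malg F[G]}) = s c * u g.
  pose T g (x : Tw) := s (mcoeff g (x : {malg F[G]})) * u g.
  have [|p pE] := @direct_extension _ _ _ (gcomp_zmod Tw) (gcomp_direct Tw) B T.
    by move=> g x y _ _; rewrite /T raddfB rmorphB mulrBl.
  exists p => c g; rewrite (pE g) ?/T ?mcoeffUU //.
  by apply/asboolP; exists c.
have pM : monoid_morphism p.
  split=> [|x y].
    rewrite -[1]/(tw_scal w 1) pE u1 -rmorphM mulfVK ?Z2_neq0 //; exact: rmorph1.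
  rewrite -[x * y]/(tw_mul w x y).
  elim/tw_gen: x => [|x x' IH IH'|c g]; first by rewrite tw_mul0l !raddf0 mul0r.
    by rewrite tw_mulDl !raddfD mulrDl -IH -IH'.
  elim/tw_gen: y => [|x x' IH IH'|d h]; first by rewrite tw_mul0r !raddf0 mulr0.
    by rewrite tw_mulDr !raddfD mulrDr -IH -IH'.
  by rewrite tw_mulU !pE /s scalACA uM mulrA -rmorphM.
pose pR : {rmorphism Tw -> B} := HB.pack (p : Tw -> B)
  (GRing.isMonoidMorphism.Build Tw B p pM) (GRing.Additive.on p).
have pcoef g x : aproj g (p x) = s (mcoeff g (x : {malg F[G]})) * u g.
  elim/tw_gen: x => [|x y IH IH'|c h]; first by rewrite !raddf0 mul0r.
    by rewrite !raddfD /= IH IH' mulrDl.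
  rewrite pE mcoeffU (aproj_id g (gcomp_scal _ (uB h))).
  by case: eqP => [->|_]; rewrite ?mulr1n // mulr0n raddf0 mul0r.
have pI : injective p.
  apply: raddf_inj => x px0; apply/malgP => g; rewrite mcoeff0.
  by apply: (scal_eq0 _ (u0 g)); rewrite -/s -pcoef px0 raddf0.
have /choice[q qE] : forall y, exists x, p x = y.
  elim/(direct_ind (gcomp_direct B)) => [|x y [x' <-] [y' <-]|g x].
  - by exists 0; rewrite raddf0.
  - by exists (x' + y'); rewrite raddfD.
  - by move=> /uS[c ->]; exists (mkmalgU g c : {malg F[G]}); rewrite pE.
have qK : cancel p q by move=> x; apply: pI; rewrite qE.
pose qR : {rmorphism B -> Tw} := HB.pack q
  (GRing.isZmodMorphism.Build B Tw q (can2_zmod_morphism qK qE))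
  (GRing.isMonoidMorphism.Build B Tw q (can2_monoid_morphism (f := pR) qK qE)).
have qU g c : q (s c * u g) = (mkmalgU g c : {malg F[G]}).
  by apply: pI; rewrite qE pE.
exists qR; split=> [|c|g x /uS[c ->]]; first by exists p.
  have E : s c = s (c / w 1%g 1%g) * u 1%g by rewrite u1 -rmorphM mulfVK ?Z2_neq0.
  by rewrite -[LHS]/(q (s c)) E qU.
by apply/asboolP; exists c; exact: qU.
Qed.

(** A graded algebra whose component of degree 1 is [F] and which has an invertible
element in each degree is a crossed product of [G] over [F], with central
scalars: a twisted group algebra. *)
Lemma twist_basis_exists B (u u' : G -> B) :
  (1 : B) != 0 ->
  (forall x, x \in gcomp B 1%g -> exists c, x = galg_scal B c) ->
  (forall g, u g \in gcomp B g) -> (forall g, u' g \in gcomp B g^-1%g) ->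
  (forall g, u g * u' g = 1) -> (forall g, u' g * u g = 1) ->
  exists w, twist_basis w u.
Proof.
move=> n0 B1 uB uB' uu' u'u.
have uS g x : x \in gcomp B g -> exists c, x = galg_scal B c * u g.
  move=> xg; have [|c E] := B1 (x * u' g).
    by rewrite -(mulgV g); apply: gcompM.
  by exists c; rewrite -E -mulrA u'u mulr1.
have /choice[w0 w0E] : forall p : G * G, exists c,
    u p.1 * u p.2 = galg_scal B c * u (p.1 * p.2)%g.
  by move=> p; apply/uS/gcompM.
pose w g h := w0 (g, h).
have wE g h : u g * u h = galg_scal B (w g h) * u (g * h)%g by apply: (w0E (g, h)).
have u0 g : u g != 0.
  by apply: contraNneq n0 => ug; rewrite -(uu' g) ug mul0r.
have wZ : Z2_pred w.
  apply/asboolP; split=> [g h|g h k].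
    apply: contraNneq n0 => w0gh; rewrite -(uu' g) -[u g]mulr1 -(uu' h) mulrA wE.
    by rewrite w0gh rmorph0 !mul0r.
  apply: (scal_inj (u0 (g * h * k)%g)).
  rewrite !rmorphM -!mulrA -wE -(mulgA g) -[in RHS]wE.
  by rewrite mulrA -wE -mulrA wE !mulrA galg_scalC.
by exists (MkZ2 wZ).
Qed.
End TwistBasis.

(** * Graded modules and their isomorphisms *)

Lemma linear_inverse (R : pzRingType) (V V' : lmodType R) (f : {linear V -> V'}) :
  bijective f -> exists g : {linear V' -> V}, cancel f g /\ cancel g f.
Proof.
move=> [g fK gK].
pose gL : {linear V' -> V} := HB.pack g
  (GRing.isZmodMorphism.Build V' V g (can2_zmod_morphism fK gK))
  (GRing.isScalable.Build R V' V *:%R g (can2_scalable fK gK)).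
by exists gL.
Qed.

Section GradedModules.
Variables (F : fieldType) (G : groupType) (A : gradedAlgebra F G).
Implicit Types (V W : gradedModule A) (M N : lmodType (base A)).

Definition degree_preserving V W (f : V -> W) : Prop :=
  forall g x, x \in mcomp V g -> f x \in mcomp W g.

Lemma graded_inverse V W : gradedMod_isomorphic V W ->
  exists (f : {linear V -> W}) (f' : {linear W -> V}),
    [/\ cancel f f', cancel f' f, degree_preserving f & degree_preserving f'].
Proof.
move=> [f /linear_inverse[f' [fK f'K]] fd]; exists f, f'; split=> // g x xg.
apply: (graded_bij_mem (mcomp_zmod V) (mcomp_direct V) (mcomp_zmod W)
  (mcomp_direct W) (can_inj fK) fd).
by rewrite -[X in X \in _]/(f (f' x)) f'K.
Qed.

(** A graded isomorphism carries the largest graded submodule vanishing in degree 1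
to its analogue: its image is one of the submodules competing for being largest. *)
Lemma tmax_image V W (f : {linear V -> W}) (f' : {linear W -> V}) :
  cancel f f' -> cancel f' f -> degree_preserving f -> degree_preserving f' ->
  forall x, f' x \in @tmax F G A V -> x \in @tmax F G A W.
Proof.
move=> fK f'K fd fd' x xt.
apply: (@tmax_max _ _ _ W [pred y | f' y \in @tmax F G A V]) => //.
  have [t0 tZ] := @tmax_submod F G A V.
  split; first split=> [|a y z yt zt].
  - by rewrite -[_ \in _]/(f' 0 \in _) raddf0.
  - by rewrite -[_ \in _]/(f' _ \in _) linearP; apply: tZ.
  - move=> y yt; have [s [h [us hC E]]] := (tmax_graded V).2 _ yt.
    exists s, (f \o h); split=> // [g|].
    by have /andP[hg ht] := hC g; rewrite !inE /= (fd _ _ hg) fK.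
    by rewrite -[y]f'K E raddf_sum.
move=> y yt y1; apply: (can_inj f'K); rewrite raddf0.
by apply: (@tmax_e _ _ _ V _ yt); apply: fd'.
Qed.

Lemma assoc_graded_map V W (f : {linear V -> W}) (f' : {linear W -> V}) :
  cancel f f' -> cancel f' f -> degree_preserving f -> degree_preserving f' ->
  exists q : {linear assoc_graded V -> assoc_graded W},
    forall x, q (qproj (@tmaxZ F G A V) x) = qproj (@tmaxZ F G A W) (f x).
Proof.
move=> fK f'K fd fd'; pose qV := qproj (@tmaxZ F G A V).
pose qW := qproj (@tmaxZ F G A W).
pose q (y : assoc_graded V) : assoc_graded W := qW (f (repr y)).
have qE x : q (qV x) = qW (f x).
  apply/eqP; rewrite /q qproj_eq -raddfB.
  apply: (tmax_image fK f'K fd fd'); rewrite fK -(qproj_eq (@tmaxZ F G A V)).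
  by rewrite /qproj reprK.
have qL : linear q.
  move=> a; elim/qproj_W=> x; elim/qproj_W=> y.
  have E : a *: qV x + qV y = qV (a *: x + y) by rewrite /qV raddfD /= -qscaleE.
  by rewrite E !qE linearP /qW raddfD /= -qscaleE.
by exists (HB.pack_for {linear assoc_graded V -> assoc_graded W} q
  (GRing.isLinear.Build A (assoc_graded V) (assoc_graded W) *:%R q qL)).
Qed.

Lemma assoc_graded_iso V W :
  gradedMod_isomorphic V W -> gradedMod_isomorphic (assoc_graded V) (assoc_graded W).
Proof.
move=> /graded_inverse[f [f' [fK f'K fd fd']]].
have [q qE] := assoc_graded_map fK f'K fd fd'.
have [q' qE'] := assoc_graded_map f'K fK fd' fd.
exists q => [|g _ /asboolP[x xg ->]].
  by exists q'; elim/qproj_W=> x; rewrite ?qE ?qE' ?qE ?fK ?f'K.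
by rewrite qE; apply/asboolP; exists (f x); rewrite ?fd.
Qed.

Local Notation "x *t m" := (tpure (@ind_ract F G A) (@ind_lact F G A _) x m)
  (at level 40).

Lemma induced_map M N (f : {linear M -> N}) :
  exists p : {linear induced M -> induced N},
    (forall x m, p (x *t m) = x *t f m) /\ degree_preserving p.
Proof.
have bal : balanced (@ind_ract F G A) (@ind_lact F G A M) (fun x m => x *t f m).
  split=> [x x' m|x m m'|x a m]; first by rewrite tpureDl.
    by rewrite raddfD tpureDr.
  by rewrite tpure_act /ind_lact linearZ.
have pL : linear (tlift bal : ind M -> ind N).
  move=> a t u; rewrite raddfD /=; congr (_ + _).
  apply: (@tens_ext _ _ _ _ _ (ind N) (tlift bal \o ind_scale a)
    (ind_scale a \o tlift bal)) => x m /=.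
  by rewrite ind_scale_pure !tlift_pure ind_scale_pure.
exists (HB.pack_for {linear induced M -> induced N} (tlift bal : ind M -> ind N)
  (GRing.isLinear.Build A (induced M) (induced N) *:%R (tlift bal) pL)).
split=> [x m|g]; first exact: tlift_pure.
apply: (tspan_additive (f := tlift bal) (ind_zmod N g)) => x m xg _ /=.
by rewrite tlift_pure; apply: tspan_pure.
Qed.

Lemma induced_iso M N (f : {linear M -> N}) :
  bijective f -> gradedMod_isomorphic (induced M) (induced N).
Proof.
move=> /linear_inverse[f' [fK f'K]].
have [p [pE pd]] := induced_map f; have [p' [pE' _]] := induced_map f'.
exists p => //; exists p'.
  by apply: (@ind_ext _ _ _ M (p' \o p) idfun) => x m; rewrite /= pE pE' fK.
by apply: (@ind_ext _ _ _ N (p \o p') idfun) => x m; rewrite /= pE' pE f'K.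
Qed.

(** Conjugation by the isomorphism. This makes the class of the cocycle depend only
on the isomorphism class of the module. *)
Lemma end_r_transport V W (w : Z2 F G) (u : G -> end_r V) :
  gradedMod_isomorphic V W -> twist_basis w u ->
  exists u' : G -> end_r W, twist_basis w u'.
Proof.
move=> /graded_inverse[f [f' [fK f'K fd fd']]] [uB u0 uS uM].
have conj (X Y : gradedModule A) (p : {linear X -> Y}) (p' : {linear Y -> X}) g
    (x : end_r X) :
    degree_preserving p -> degree_preserving p' -> x \in gcomp (end_r X) g ->
    exists y : end_r Y, y \in gcomp (end_r Y) g /\ forall v, y v = p (x (p' v)).
  move=> pd pd' /asboolP[_ xd].
  have yP : (fun v => p (x (p' v))) \in @endr_comp F G A Y g.
    apply/asboolP; split=> [a v v'|h v vh]; last by apply/pd/xd/pd'.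
    by rewrite !linearP.
  by exists (Endr (endr_comp_pred yP)).
have /choice[u' /all_and2[uB' uE']] g := conj _ _ f f' g (u g) fd fd' (uB g).
exists u'; split=> // [g|g y yg|g h].
- apply: contra_neq (u0 g) => ug; apply: endr_ext => v.
  by rewrite -[v in LHS]fK -[LHS]fK -uE' ug /= raddf0.
- have [x [xg xE]] := conj _ _ f' f g y fd' fd yg.
  have [c cE] := uS _ _ xg; exists c; apply: endr_ext => v.
  have -> : y v = f (x (f' v)) by rewrite xE !f'K.
  by rewrite cE; transitivity (u' g (galg_scal A c *: v)); rewrite // uE' linearZ.
- apply: endr_ext => v.
  have -> : (u' g * u' h) v = f ((u g * u h) (f' v)).
    by rewrite -[LHS]/(u' h (u' g v)) !uE' fK.
  rewrite uM; transitivity (u' (g * h)%g (galg_scal A (w g h) *: v)) => //.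
  by rewrite uE' linearZ.
Qed.
End GradedModules.

(** * The endomorphism algebra of the associated graded module *)

Section Obstruction.
Variables (F : fieldType) (G : groupType) (A : gradedAlgebra F G).
Implicit Types (V : gradedModule A) (M N : lmodType (base A)).

(** The conclusion of Schur's lemma, as it holds for absolutely simple modules. *)
Definition brick M : Prop := (exists m : M, m != 0) /\
  forall f : {linear M -> M}, exists c : F, forall m, f m = base_scal A c *: m.

Lemma brick_iso M N (f : {linear M -> N}) : bijective f -> brick M -> brick N.
Proof.
move=> /linear_inverse[f' [fK f'K]] [[m m0] Mc]; split.
  by exists (f m); apply: contra_neq m0 => fm; rewrite -[m]fK fm raddf0.
move=> p; have pL : linear (f' \o p \o f) by move=> a x y; rewrite /= !linearP.
have [c cE] := Mc (HB.pack_for {linear M -> M} (f' \o p \o f)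
  (GRing.isLinear.Build (base A) M M *:%R (f' \o p \o f) pL)).
by exists c => n; rewrite -[LHS]f'K -{1}[n]f'K [f' _]cE linearZ /= f'K.
Qed.

(** [j] identifies [M] with the component of degree 1, and this component generates
[V]. This is how the associated graded module of the induced module is accessed. *)
Definition generates M V (j : {additive M -> V}) : Prop :=
  [/\ injective j,
      forall v, v \in mcomp V 1%g <-> exists m, v = j m,
      forall (a : base A) m, j (a *: m) = base_val a *: j m
    & forall g v, v \in mcomp V g -> exists s : seq (A * M),
        all (fun p => p.1 \in gcomp A g) s /\ v = \sum_(p <- s) p.1 *: j p.2].

(** The only delicate point is the injectivity of [j]: the tensor [1 (x) m] has
degree 1, so it cannot vanish in the quotient unless it is zero, and then [m] is
recovered by the map [x (x) n |-> x_1 n], where [x_1] is the component of degree 1. *)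
Lemma graded_induced_generates M :
  exists j : {additive M -> graded_induced M}, generates j.
Proof.
pose pure := tpure (@ind_ract F G A) (@ind_lact F G A M).
pose W := induced M; pose qm := qproj (@tmaxZ F G A W).
pose j (m : M) : graded_induced M := qm (pure 1 m).
have jB : zmod_morphism j.
  by move=> m n; rewrite /j /pure tpureDr tpureNr /qm raddfB.
have qZ a t : qm (a *: t) = a *: qm t by apply/esym/qscaleE.
have ZE a x m : a *: (pure x m : W) = pure (a * x) m by apply: ind_scale_pure.
have jE a m : qm (pure a m) = a *: j m by rewrite -qZ ZE mulr1.
have gen g (v : graded_induced M) : v \in mcomp (graded_induced M) g ->
    exists s : seq (A * M),
      all (fun p => p.1 \in gcomp A g) s /\ v = \sum_(p <- s) p.1 *: j p.2.
  move=> /asboolP[t /asboolP[s [sA ->]] ->]; exists s; split.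
    by apply: sub_all sA => p /andP[].
  by rewrite /qm raddf_sum; apply: eq_bigr => p _; rewrite -jE.
have jZ (a : base A) m : j (a *: m) = base_val a *: j m.
  by rewrite -jE /j /pure -(tpure_act (@ind_ract F G A)) /ind_ract mul1r.
pose jA := HB.pack_for {additive M -> graded_induced M} j
  (GRing.isZmodMorphism.Build M (graded_induced M) j jB).
exists jA; split=> //.
- apply: raddf_inj => m jm0.
  pose ev (x : A) (n : M) : M := (Base (aproj_mem 1%g x) : base A) *: n.
  have bal : balanced (@ind_ract F G A) (@ind_lact F G A M) ev.
    split=> [x x' n|x n n'|x a n]; rewrite /ev ?scalerDr //.
      by rewrite -scalerDl; congr (_ *: _); apply: val_inj; rewrite /= !raddfD.
    rewrite /ind_ract /ind_lact scalerA; congr (_ *: _); apply: val_inj.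
    by rewrite rmorphM /= aproj_mulr.
  have : pure 1 m = 0.
    apply: (@tmax_e F G A W (pure 1 m)); last first.
      by apply: tspan_pure => //; apply: gcomp1.
    by rewrite -(qproj_eq0 (@tmaxZ F G A W)); apply/eqP.
  move=> /(congr1 (tlift bal)); rewrite raddf0 tlift_pure => <-.
  rewrite /ev -[LHS]scale1r; congr (_ *: _); apply: val_inj => /=.
  by rewrite (aproj_id _ (gcomp1 A)) eqxx.
- move=> v; split=> [/gen[s [sA ->]]|[m ->]]; last first.
    by apply/asboolP; exists (pure 1 m) => //; apply: tspan_pure => //; apply: gcomp1.
  elim: s sA => [|[a m] s IH] /=; first by exists 0; rewrite big_nil [RHS](raddf0 jA).
  move=> /andP[ae /IH[n nE]]; exists ((Base ae : base A) *: m + n).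
  by rewrite big_cons nE [RHS](raddfD jA) -[jA (_ *: _)]/(j _) jZ.
Qed.

Section Model.
Variables (M : lmodType (base A)) (V : gradedModule A) (j : {additive M -> V}).
Hypotheses (jg : generates j) (Mb : brick M).

(** Such an endomorphism stabilizes the component of degree 1, which is a copy of
[M] on which it acts by a scalar, and that component generates [V]. *)
Lemma end_e_scal (x : end_r V) : x \in gcomp (end_r V) 1%g ->
  exists c, x = galg_scal (end_r V) c.
Proof.
have [jI je jZ jgen] := jg; move=> /asboolP[xL xd].
have /choice[f fE] m : exists n, x (j m) = j n.
  by apply/je; rewrite -[1%g]mulg1; apply/xd/je; exists m.
have fL : linear f.
  by move=> a m n; apply: jI; rewrite -fE (raddfD j) jZ xL !fE -jZ -raddfD.
have [c cE] := Mb.2 (HB.pack_for {linear M -> M} f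
  (GRing.isLinear.Build (base A) M M *:%R f fL)).
exists c; apply: endr_ext => v; rewrite -[RHS]/(galg_scal A c *: v).
elim/(direct_ind (mcomp_direct V)): v => [|v v' IH IH'|g v].
- by rewrite raddf0 scaler0.
- by rewrite raddfD scalerDr /= IH IH'.
- move=> /jgen[s [_ ->]]; rewrite raddf_sum scaler_sumr; apply: eq_bigr => p _ /=.
  by rewrite linearZ /= fE [f _]cE jZ /= !scalerA galg_scalC.
Qed.

(** A graded isomorphism from [V] to its suspension by [g], read as a map from [V]
to itself, is an invertible endomorphism of degree [g]. *)
Lemma end_r_basis : (forall g, gradedMod_isomorphic V (suspension g V)) ->
  exists (w : Z2 F G) (u : G -> end_r V), twist_basis w u.
Proof.
move=> inv; have [jI _ _ _] := jg.
have /choice[u /choice[u' H]] g : exists u u' : end_r V,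
    [/\ u \in gcomp (end_r V) g, u' \in gcomp (end_r V) g^-1%g,
        u * u' = 1 & u' * u = 1].
  have [f [f' [fK f'K fd fd']]] := graded_inverse (inv g).
  have fP : (f : V -> V) \in endr_comp g.
    by apply/asboolP; split=> [a x y|k x /fd //]; rewrite linearP.
  have fP' : (f' : V -> V) \in endr_comp g^-1%g.
    apply/asboolP; split=> [a x y|k x xk]; first by rewrite linearP.
    by apply: fd'; rewrite -[_ \in _]/(x \in mcomp V _) mulgVK.
  exists (Endr (endr_comp_pred fP)), (Endr (endr_comp_pred fP')).
  split=> //; apply: endr_ext => v.
    by rewrite -[LHS]/(f' (f v)) fK -[RHS]/(galg_scal A 1 *: v) rmorph1 scale1r.
  by rewrite -[LHS]/(f (f' v)) f'K -[RHS]/(galg_scal A 1 *: v) rmorph1 scale1r.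
have [w wP] : exists w, twist_basis w u.
  apply: (@twist_basis_exists _ _ (end_r V) u u'); last 4 first.
  - by move=> g; case: (H g).
  - by move=> g; case: (H g).
  - by move=> g; case: (H g).
  - by move=> g; case: (H g).
  - have [m m0] := Mb.1; apply: contra_neq m0 => e; apply: jI; rewrite raddf0.
    have : (1 : end_r V) (j m) = (0 : end_r V) (j m) by rewrite e.
    by rewrite -[LHS]/(galg_scal A 1 *: j m) rmorph1 scale1r.
  - exact: end_e_scal.
by exists w, u.
Qed.
End Model.

(** The operators [T g a] stand for the action of [v_g (x) a], [a] of degree [g], in
a module over the twist by [alpha] whose restriction to the base algebra is [M].
The values of [T g] outside degree [g] are junk.
As [1 (x) a] is [(alpha 1 1)^-1 v_1 (x) a], the operator [T 1 a] is
[alpha 1 1] times the action of [a]. *)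
Definition twisted_action M (alpha : Z2 F G) (T : G -> A -> M -> M) : Prop :=
  [/\ forall g a, a \in gcomp A g -> zmod_morphism (T g a),
      forall g m, {in gcomp A g &, {morph (T g)^~ m : a b / a - b}},
      forall (a : base A) m,
        T 1%g (base_val a) m = base_scal A (alpha 1%g 1%g) *: (a *: m)
    & forall g h a b m, a \in gcomp A g -> b \in gcomp A h ->
        T g a (T h b m) = base_scal A (alpha g h) *: T (g * h)%g (a * b) m].

(** The action is [T g a m := j^-1 (u_g^-1 (a (j m)))]. It is characterized by
[u g (j (T g a m)) = a *: j m], and since [u g \o j] is injective, each required
identity may be checked after applying it. The product of endomorphisms applies
the left factor first, whence [u h (u g v) = w g h *: u (g h) v]; undoing [u g]
and [u h] therefore introduces the inverse of [w]. *)
Lemma basis_twisted_action M V (j : {additive M -> V}) (w : Z2 F G)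
    (u : G -> end_r V) :
  generates j -> twist_basis w u ->
  exists T : G -> A -> M -> M, twisted_action w^-1%g T.
Proof.
move=> [jI je jZ _] bu; have u1 := twist_basis1 bu; have [uB u0 uS uM] := bu.
have uE g h v : u h (u g v) = galg_scal A (w g h) *: u (g * h)%g v.
  rewrite -[LHS]/((u g * u h) v) uM -[LHS]/(u (g * h)%g (_ *: v)).
  by rewrite linearZ.
have scK c (v : V) : c != 0 -> galg_scal A c^-1 *: (galg_scal A c *: v) = v.
  by move=> c0; rewrite scalerA -rmorphM mulVf // rmorph1 scale1r.
have u1E v : u 1%g v = galg_scal A (w 1%g 1%g) *: v by rewrite u1.
have ujI g : injective (u g \o j).
  move=> m n /= /(congr1 (u g^-1%g)); rewrite !uE mulgV !u1E.
  by do 2 move=> /(can_inj (scK _ ^~ (Z2_neq0 w _ _))); move/jI.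
have ex (p : G * A * M) : exists m', p.1.2 \in gcomp A p.1.1 ->
    u p.1.1 (j m') = p.1.2 *: j p.2.
  case: p => [[g a] m] /=; case: (boolP (a \in gcomp A g)) => [ag|_]; last by exists 0.
  have [m' m'E] : exists m', u g^-1%g (a *: j m) = j m'.
    apply/je; have /asboolP[_ ud] := uB g^-1%g.
    rewrite -(mulgV g); apply: ud; rewrite -[g]mulg1; apply: mcompZ => //.
    by apply/je; exists m.
  (* Up to the scalar [c], the inverse of [u g] is [u g^-1]. *)
  pose c := w g^-1%g g * w 1%g 1%g; exists (base_scal A c^-1 *: m') => _.
  rewrite jZ /= linearZ /= -m'E uE mulVg u1E.
  rewrite (scalerA (galg_scal A (w _ _))) -rmorphM scK //.
  by rewrite mulf_neq0 ?Z2_neq0.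
have /choice[T0 T0E] := ex; pose T g a m := T0 (g, a, m).
have TE g a m : a \in gcomp A g -> u g (j (T g a m)) = a *: j m.
  exact: (T0E (g, a, m)).
exists T; split=> [g a ag m n|g m a b ag bg|a m|g h a b m ag bh].
- by apply: (ujI g); rewrite /= !raddfB /= !TE // raddfB scalerBr.
- apply: (ujI g); rewrite /= !raddfB /= !TE // ?scalerBl //.
  by have [_] := gcomp_zmod A g; apply.
- apply: (ujI 1%g); rewrite /= TE ?base_valP // !jZ u1E /= scalerA -rmorphM.
  by rewrite mulfV ?Z2_neq0 // rmorph1 scale1r.
- have abgh := gcompM ag bh.
  apply: (ujI (g * h)%g); rewrite /= jZ linearZ /= [in RHS]TE //.
  by rewrite -[LHS](scK (w g h)) ?Z2_neq0 // -uE !TE // linearZ /= TE // !scalerA mulrA.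
Qed.

End Obstruction.

(** * Modules from homogeneous actions *)

(** An alias carrying only the additive structure, to which a scalar action can be
attached. *)
Definition module_copy (U : zmodType) : Type := U.
HB.instance Definition _ (U : zmodType) := GRing.Zmodule.on (module_copy U).

(** A module over a graded algebra is the same as a compatible family of actions of
its components. The extension to all of [B] is taken with values in the group of
functions [U -> U], and its properties are checked on homogeneous elements. *)
Lemma graded_action_module (F : fieldType) (G : groupType) (B : gradedAlgebra F G)
    (U : zmodType) (T : G -> B -> U -> U) :
  (forall g b, b \in gcomp B g -> zmod_morphism (T g b)) ->
  (forall g u, {in gcomp B g &, {morph (T g)^~ u : a b / a - b}}) ->
  (forall u, T 1%g 1 u = u) ->
  (forall g h a b u, a \in gcomp B g -> b \in gcomp B h ->
     T g a (T h b u) = T (g * h)%g (a * b) u) ->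
  exists (N : lmodType B) (f : {additive U -> N}),
    bijective f /\ forall g b u, b \in gcomp B g -> f (T g b u) = b *: f u.
Proof.
move=> TB TA T1 TM.
have [|act actE] := @direct_extension _ _ _ (gcomp_zmod B) (gcomp_direct B) (U -> U) T.
  by move=> g a b ag bg; apply: funext => u; apply: TA.
have actD b : {morph act b : u v / u + v}.
  move=> u v; elim/(direct_ind (gcomp_direct B)): b => [|a b IH IH'|g b bg].
  - by rewrite raddf0 /= addr0.
  - by rewrite raddfD -![(_ + _) _]/(_ _ + _ _) IH IH' addrACA.
  - pose Tb : {additive U -> U} :=
      HB.pack (T g b) (GRing.isZmodMorphism.Build U U (T g b) (TB g b bg)).
    by rewrite (actE g) //; exact: (raddfD Tb).
have act0 b : act b 0 = 0 by apply: (addrI (act b 0)); rewrite -actD !addr0.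
have actA a b u : act a (act b u) = act (a * b) u.
  elim/(direct_ind (gcomp_direct B)): a => [|a a' IH IH'|g a ag].
  - by rewrite mul0r !raddf0.
  - by rewrite mulrDl !raddfD -![(_ + _) _]/(_ _ + _ _) IH IH'.
  elim/(direct_ind (gcomp_direct B)): b => [|b b' IH IH'|h b bh].
  - by rewrite mulr0 !raddf0 -[X in act a X]/(0 : U) act0.
  - by rewrite mulrDr !raddfD -![(_ + _) _]/(_ _ + _ _) actD IH IH'.
  - by rewrite (actE g) // (actE h) // (actE (g * h)%g) ?TM ?gcompM.
have act1 : left_id 1 act by move=> u; rewrite (actE 1%g) ?gcomp1.
have actDl u : {morph act^~ u : a b / a + b} by move=> a b; rewrite raddfD.
pose N : lmodType B := HB.pack (module_copy U)
  (GRing.Zmodule_isLmodule.Build B (module_copy U) actA act1 actD actDl).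
have idB : zmod_morphism (id : U -> N) by [].
exists N, (HB.pack_for {additive U -> N} (id : U -> N)
  (GRing.isZmodMorphism.Build U N id idB)).
split=> [|g b u bg]; first by exists id.
by rewrite -[RHS]/(act b u) (actE g).
Qed.

Section BaseScalars.
Variables (F : fieldType) (G : groupType) (A : gradedAlgebra F G).
Variables (M : lmodType (base A)).
Implicit Types (c d : F) (m : M).

Lemma base_scalA c d m :
  base_scal A c *: (base_scal A d *: m) = base_scal A (c * d) *: m.
Proof.
by rewrite scalerA; congr (_ *: _); apply: val_inj; rewrite rmorphM /= rmorphM.
Qed.

Lemma base_scal1 m : base_scal A 1 *: m = m.
Proof.
by rewrite -[RHS]scale1r; congr (_ *: _); apply: val_inj; rewrite /= rmorph1.
Qed.

Lemma base_scalI c : c != 0 -> injective (fun m => base_scal A c *: m).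
Proof.
move=> c0; apply: (can_inj (g := fun m => base_scal A c^-1 *: m)) => m.
by rewrite base_scalA mulVf // base_scal1.
Qed.

Lemma base_scal_injl c d m : m != 0 -> base_scal A c *: m = base_scal A d *: m -> c = d.
Proof.
move=> m0 E; apply/eqP; rewrite -subr_eq0; apply: contraT => cd0.
case/eqP: m0; apply: (base_scalI cd0); rewrite /= scaler0.
have -> : base_scal A (c - d) = base_scal A c - base_scal A d.
  by apply: val_inj; rewrite raddfB /= rmorphB.
by rewrite scalerBl E subrr.
Qed.
End BaseScalars.

Section Restrictions.
Variables (F : fieldType) (G : groupType) (A : gradedAlgebra F G).
Variables (M : lmodType (base A)).
Implicit Types (alpha beta : Z2 F G) (T S : G -> A -> M -> M).

Lemma base_memMl g (x : base A) a : a \in gcomp A g -> base_val x * a \in gcomp A g.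
Proof. by move=> ag; rewrite -[g]mul1g; apply: gcompM => //; apply: base_valP. Qed.
Lemma base_memMr g a (x : base A) : a \in gcomp A g -> a * base_val x \in gcomp A g.
Proof. by move=> ag; rewrite -[g]mulg1; apply: gcompM => //; apply: base_valP. Qed.

Section ActionTheory.
Variables (alpha : Z2 F G) (T : G -> A -> M -> M) (aT : twisted_action alpha T).

Lemma twisted_action_sumr g a (I : Type) (s : seq I) (f : I -> M) :
  a \in gcomp A g -> T g a (\sum_(i <- s) f i) = \sum_(i <- s) T g a (f i).
Proof.
case: aT => /(_ g a) TB _ _ _ ag.
pose Ta : {additive M -> M} :=
  HB.pack (T g a) (GRing.isZmodMorphism.Build M M (T g a) (TB ag)).
exact: (raddf_sum Ta).
Qed.

Lemma twisted_action_suml g (I : Type) (s : seq I) (f : I -> A) m :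
  (forall i, f i \in gcomp A g) ->
  T g (\sum_(i <- s) f i) m = \sum_(i <- s) T g (f i) m.
Proof.
case: aT => _ TA _ _ fg; have [C0 CB] := gcomp_zmod A g.
have T0 : T g 0 m = 0 by rewrite -[in LHS](subrr 0) TA // subrr.
have CN x : x \in gcomp A g -> - x \in gcomp A g by rewrite -sub0r; apply: CB.
have TD x y : x \in gcomp A g -> y \in gcomp A g -> T g (x + y) m = T g x m + T g y m.
  by move=> xg yg; rewrite -[y in LHS]opprK TA ?CN // -[- y]sub0r TA // T0 sub0r opprK.
suff : (\sum_(i <- s) f i \in gcomp A g) /\
    T g (\sum_(i <- s) f i) m = \sum_(i <- s) T g (f i) m by case.
elim: s => [|i s [IHg IH]]; rewrite ?big_nil // !big_cons TD // IH; split=> //.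
by rewrite -[_ s]opprK; apply: CB => //; apply: CN.
Qed.

Lemma twisted_actionMl g (x : base A) a m : a \in gcomp A g ->
  T g (base_val x * a) m = x *: T g a m.
Proof.
case: aT => _ _ T1 TM ag; have := TM 1%g g (base_val x) a m (base_valP x) ag.
by rewrite T1 mul1g Z2_1l => /(base_scalI (Z2_neq0 _ _ _)).
Qed.

(** Write [x *: m] as [T 1 y m], where [y] is [x] divided by [alpha 1 1], and use the
composition rule. *)
Lemma twisted_actionMr g a (x : base A) m : a \in gcomp A g ->
  T g (a * base_val x) m = T g a (x *: m).
Proof.
case: aT => _ _ T1 TM ag; pose c := alpha 1%g 1%g.
pose y : base A := base_scal A c^-1 * x.
have -> : x *: m = T 1%g (base_val y) m.
  by rewrite T1 -scalerA base_scalA mulfV ?Z2_neq0 // base_scal1.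
have yE : base_val y = galg_scal A c^-1 * base_val x by [].
rewrite TM ?base_valP // mulg1 Z2_1r -/c yE mulrA -galg_scalC -mulrA.
rewrite (@twisted_actionMl g (base_scal A c^-1)) ?base_memMr //.
by rewrite base_scalA mulfV ?Z2_neq0 // base_scal1.
Qed.
End ActionTheory.

(** Stated with projections so that all the terms are homogeneous, including those
indexed by pairs outside the list. *)
Lemma strong_unit g : strongly_graded A -> exists s : seq (A * A),
  1 = \sum_(p <- s) aproj g p.1 * aproj g^-1%g p.2.
Proof.
move=> /(_ g g^-1%g 1); rewrite mulgV gcomp1 => /asboolP[s [sP ->]]; exists s.
apply: eq_big_seq => p /(allP sP)/andP[p1 p2].
by rewrite (aproj_id _ p1) (aproj_id _ p2) !eqxx.
Qed.

(** If [T g] killed [m], so would [1], a sum of products of elements of degrees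
[g^-1] and [g]. *)
Lemma twisted_action_nondeg alpha T g m :
  strongly_graded A -> twisted_action alpha T -> m != 0 ->
  exists2 a, a \in gcomp A g & T g a m != 0.
Proof.
move=> sA aT m0; have [s] := strong_unit g^-1%g sA; rewrite invgK => s1.
have [TB TA T1 TM] := aT.
apply: contra_notP (elimN eqP m0) => Tm.
have {}Tm a : a \in gcomp A g -> T g a m = 0.
  by move=> ag; apply/eqP; apply: contra_notT Tm => ?; exists a.
apply: (base_scalI (Z2_neq0 alpha 1%g 1%g)); rewrite /= scaler0.
have -> : m = (1 : base A) *: m by rewrite scale1r.
rewrite -T1 [base_val _]s1 (twisted_action_suml aT) => [|p]; last first.
  by rewrite -(mulVg g) gcompM ?aproj_mem.
rewrite big1 // => p _; apply: (base_scalI (Z2_neq0 alpha g^-1%g g)).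
rewrite -(mulVg g) -TM ?aproj_mem // Tm ?aproj_mem // scaler0.
have := TB g^-1%g _ (aproj_mem g^-1%g p.1) 0 0.
by rewrite subrr [X in _ = X]subrr.
Qed.

Lemma twisted_action_scal alpha T g a c m :
  twisted_action alpha T -> a \in gcomp A g ->
  T g a (base_scal A c *: m) = base_scal A c *: T g a m.
Proof.
move=> aT ag; rewrite -(twisted_actionMr aT) //= -galg_scalC.
exact: (twisted_actionMl aT (base_scal A c)).
Qed.
End Restrictions.

(** * Comparison of two twisted actions *)

Section Comparison.
Variables (F : fieldType) (G : groupType) (A : gradedAlgebra F G).
Variables (M : lmodType (base A)) (alpha beta : Z2 F G) (T S : G -> A -> M -> M).
Hypotheses (sA : strongly_graded A) (bM : brick M).
Hypotheses (aT : twisted_action alpha T) (aS : twisted_action beta S).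

(** With [1 = sum_i x_i y_i], [x_i] in degree [g] and [y_i] in degree [g^-1], the
operator [theta m = sum_i T g x_i (S g^-1 y_i m)] is an endomorphism of the
module [M]: inserting a second decomposition of [1] moves an element of the base
algebra across. So [theta] is a scalar. On the other hand [y_i a] has degree 1
for [a] in degree [g], whence [theta (S g a m)] is [T g a m] up to a nonzero
factor. *)
Lemma twisted_action_proportional g : exists c : F, forall a m,
  a \in gcomp A g -> T g a m = base_scal A c *: S g a m.
Proof.
pose h := g^-1%g; have [s s1] := strong_unit g sA.
have [TB TA T1 TM] := aT; have [SB SA S1 SM] := aS.
pose x (p : A * A) := aproj g p.1; pose y (p : A * A) := aproj h p.2.
have xg p : x p \in gcomp A g by apply: aproj_mem.
have yh p : y p \in gcomp A h by apply: aproj_mem.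
have yx1 b a : b \in gcomp A h -> a \in gcomp A g -> b * a \in gcomp A 1%g.
  by move=> bh ag; rewrite -(mulVg g); apply: gcompM.
pose theta m := \sum_(p <- s) T g (x p) (S h (y p) m).
pose c := beta h g * beta 1%g 1%g.
have thetaS a m : a \in gcomp A g -> theta (S g a m) = base_scal A c *: T g a m.
  move=> ag; have aE : a = \sum_(p <- s) x p * (y p * a).
    by rewrite -[LHS]mul1r s1 mulr_suml; apply: eq_bigr => p _; rewrite mulrA.
  rewrite [in RHS]aE (twisted_action_suml aT) => [|p]; last first.
    exact: (base_memMr (Base (yx1 _ _ (yh p) ag)) (xg p)).
  rewrite scaler_sumr; apply: eq_bigr => p _; pose b := Base (yx1 _ _ (yh p) ag).
  have -> : S h (y p) (S g a m) = base_scal A c *: (b *: m).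
    by rewrite SM // mulVg (S1 b) base_scalA.
  by rewrite (twisted_action_scal _ _ aT) // -(twisted_actionMr aT).
(* [b p q] is y_p z x_q, an element of the base algebra. *)
have thetaZ (z : base A) m : theta (z *: m) = z *: theta m.
  pose b p q : base A := Base (yx1 _ _ (base_memMr z (yh p)) (xg q)).
  have yz p : S h (y p) (z *: m) = \sum_(q <- s) b p q *: S h (y q) m.
    rewrite -(twisted_actionMr aS) //.
    have {1}-> : y p * base_val z = \sum_(q <- s) base_val (b p q) * y q.
      rewrite -[LHS]mulr1 s1 mulr_sumr; apply: eq_bigr => q _ /=.
      by rewrite mulrA.
    rewrite (twisted_action_suml aS) => [|q]; last exact: base_memMl.
    by apply: eq_bigr => q _; rewrite (twisted_actionMl aS).
  rewrite /theta (eq_bigr (fun p => \sum_(q <- s)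
    T g (x p * (y p * base_val z * x q)) (S h (y q) m))); last first.
    move=> p _; rewrite yz (twisted_action_sumr aT) //; apply: eq_bigr => q _.
    by rewrite -(twisted_actionMr aT).
  rewrite exchange_big scaler_sumr; apply: eq_bigr => q _ /=.
  rewrite -(twisted_action_suml aT) => [|p]; last exact: (base_memMr (b p q) (xg p)).
  rewrite -(twisted_actionMl aT) //; congr (T g _ _).
  rewrite -[in RHS](mul1r (base_val z)) s1 !mulr_suml; apply: eq_bigr => p _.
  by rewrite !mulrA.
have thetaB : zmod_morphism theta.
  move=> m n; rewrite /theta -sumrB; apply: eq_bigr => p _.
  by rewrite SB // TB.
have [d dE] := bM.2 (HB.pack_for {linear M -> M} theta
  (GRing.isZmodMorphism.Build M M theta thetaB)
  (GRing.isScalable.Build (base A) M M *:%R theta thetaZ)).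
have c0 : c != 0 by rewrite mulf_neq0 ?Z2_neq0.
exists (c^-1 * d) => a m ag; rewrite -base_scalA -dE.
by rewrite -[GRing.Linear.sort _ _]/(theta _) thetaS // base_scalA mulVf // base_scal1.
Qed.

(** The ratios [l g] of [T g] to [S g] form the cochain. Both sides of the
composition rule for [T] are multiples of a single vector
[S (g * h) (a * b) m], which can be chosen nonzero; compare coefficients. *)
Lemma twisted_action_cohom : cohomologous alpha beta.
Proof.
have [l lE] := choice twisted_action_proportional.
have [TB TA T1 TM] := aT; have [SB SA S1 SM] := aS.
have [m m0] := bM.1.
have l0 g : l g != 0.
  have [a ag am] := twisted_action_nondeg g sA aT m0.
  apply: contraNneq am => lg; rewrite lE // lg.
  have -> : base_scal A 0 = 0 by apply: val_inj; rewrite /= !rmorph0.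
  by rewrite scale0r.
apply/asboolP; exists l => // g h.
have [b bh bm] := twisted_action_nondeg h sA aS m0.
have [a ag abm] := twisted_action_nondeg g sA aS bm.
have abm0 : S (g * h)%g (a * b) m != 0.
  by apply: contraNneq abm => E; rewrite SM // E scaler0.
have E : alpha g h * l (g * h)%g = l g * l h * beta g h.
  apply: (base_scal_injl abm0); rewrite -!base_scalA -SM // -lE ?gcompM // -TM //.
  by rewrite !lE // (twisted_action_scal _ _ aS) // !base_scalA.
by apply: (mulIf (l0 (g * h)%g)); rewrite E mulrA mulfVK // mulrC.
Qed.
End Comparison.

(** * Twisted actions and modules over twists *)

Section Realizations.
Variables (F : fieldType) (G : groupType) (A : gradedAlgebra F G).
Variables (M : lmodType (base A)).
Implicit Types (alpha : Z2 F G) (T : G -> A -> M -> M).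

Section Coefficients.
Variable alpha : Z2 F G.
Local Notation tw := (twisted alpha).
Local Notation ract := (@talg_ract F G tw).
Local Notation lact := (@talg_lact F G A).
Local Notation "x *t y" := (tpure ract lact x y) (at level 40).
Local Notation v g c := (mkmalgU g c : twalg F G).

Definition twcoef (g : G) (x : tw) : F := mcoeff g (x : {malg F[G]}).

Lemma twcoef_balanced g : balanced ract lact (fun x y => galg_scal A (twcoef g x) * y).
Proof.
split=> [x x' y|x y y'|x c y].
- by rewrite /twcoef raddfD rmorphD mulrDl.
- by rewrite mulrDr.
rewrite /talg_lact mulrA -rmorphM; congr (galg_scal A _ * y).
rewrite /talg_ract -galg_scalC -[_ * x]/(tw_mul alpha (tw_scal alpha c) x).
elim/tw_gen: x => [|x x' IH IH'|d h].
- by rewrite tw_mul0r /twcoef mcoeff0 mul0r.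
- by rewrite tw_mulDr /twcoef !mcoeffD mulrDl -IH -IH'.
- by rewrite tw_scalU /twcoef !mcoeffU -mulrnAr mulrC.
Qed.

(** On a homogeneous tensor [v_g (x) a] of the graded product this recovers [a], so
it makes explicit that the component of degree [g] of the twist is a copy of that
of [A]. *)
Definition gpr_coef (g : G) (t : talg tw A) : A := tlift (twcoef_balanced g) t.
HB.instance Definition _ g := GRing.isZmodMorphism.Build (talg tw A) A (gpr_coef g)
  (tlift_is_additive (twcoef_balanced g)).

Lemma gpr_coef_pure g (c : F) (a : A) :
  gpr_coef g (talg_pure (v g c : tw) a) = galg_scal A c * a.
Proof. by rewrite /gpr_coef tlift_pure /twcoef mcoeffUU. Qed.

Lemma gpr_coef_mem g t : t \in gpr_comp g -> gpr_coef g t \in gcomp A g.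
Proof.
move: t; apply: (tspan_additive (f := gpr_coef g) (gcomp_zmod A g)) => x a _ ag.
by rewrite /= /gpr_coef tlift_pure; apply: gcomp_scal.
Qed.

Lemma gpr_coefM g h t t' : t \in gpr_comp g -> t' \in gpr_comp h ->
  gpr_coef (g * h)%g (t * t') =
    galg_scal A (alpha g h) * (gpr_coef g t * gpr_coef h t').
Proof.
move=> /asboolP[s [sP ->]] /asboolP[s' [sP' ->]].
rewrite mulr_suml !raddf_sum mulr_suml mulr_sumr; apply: eq_big_seq => -[x a].
move=> /(allP sP)/andP[/asboolP[c /= ->] ag].
rewrite mulr_sumr !raddf_sum !mulr_sumr; apply: eq_big_seq => -[x' b].
move=> /(allP sP')/andP[/asboolP[d /= ->] bh].
rewrite -![_ *t _]/(talg_pure _ _) talg_pureM.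
rewrite -[X in talg_pure X]/(tw_mul alpha _ _) tw_mulU !gpr_coef_pure.
by rewrite scalACA [RHS]mulrA -rmorphM (mulrC (alpha g h)).
Qed.
End Coefficients.

Lemma gpr_valB alpha (t t' : twist A alpha) :
  gpr_val (t - t') = gpr_val t - gpr_val t'.
Proof. exact: (raddfB (val : gpr (twisted alpha) A -> talg (twisted alpha) A)). Qed.

Lemma gpr_valM alpha (t t' : twist A alpha) :
  gpr_val (t * t') = gpr_val t * gpr_val t'.
Proof. exact: (rmorphM (val : gpr (twisted alpha) A -> talg (twisted alpha) A)). Qed.

Lemma twisted_action_restricted alpha T :
  twisted_action alpha T -> restricted_from_twist alpha M.
Proof.
move=> aT; have [TB TA T1 TM] := aT.
pose c1 := alpha 1%g 1%g; have c10 : c1 != 0 by apply: Z2_neq0.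
pose T' g (t : twist A alpha) := T g (gpr_coef g (gpr_val t)).
have coefB g (t : twist A alpha) : t \in gcomp (twist A alpha) g ->
  gpr_coef g (gpr_val t) \in gcomp A g by exact: gpr_coef_mem.
have coef1 (x : base A) :
    gpr_coef 1%g (gpr_val (twist_base alpha x)) = base_val (base_scal A c1^-1 * x).
  by rewrite /= -[1]/(tw_scal alpha 1) gpr_coef_pure mul1r.
have T'1 x m : T' 1%g (twist_base alpha x) m = x *: m.
  by rewrite /T' coef1 T1 -scalerA base_scalA mulfV // base_scal1.
have [||m|g h t t' m tg th|N [f [fbij fE]]] :=
    @graded_action_module F G (twist A alpha) M T'.
- by move=> g t tg; apply/TB/coefB.
- move=> g m t t' tg tg'; rewrite /T' -TA ?coefB //.
  by rewrite gpr_valB raddfB.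
- by rewrite -[1](rmorph1 (twist_base alpha)) T'1 scale1r.
- rewrite /T' TM ?coefB // gpr_valM gpr_coefM //.
  rewrite (@twisted_actionMl _ _ _ _ _ _ aT _ (base_scal A (alpha g h))) //.
  by apply: gcompM; apply: coefB.
exists N, f; split=> // x m; rewrite -(fE 1%g) ?T'1 //.
by apply: tspan_pure; rewrite ?base_valP //; apply: gcomp1.
Qed.

Lemma restricted_twisted_action alpha :
  restricted_from_twist alpha M -> exists T, twisted_action alpha T.
Proof.
move=> [N [f [[f' fK f'K] fE]]].
have vP g : (mkmalgU g 1 : twisted alpha) \in gcomp (twisted alpha) g.
  by apply/asboolP; exists 1.
pose P g (a : A) : twist A alpha := Gpr (gpr_pure_subproof (vP g) (aproj_mem g a)).
pose T g a m := f' (P g a *: f m).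
have fT g a m : f (T g a m) = P g a *: f m by apply: f'K.
have PE g a : a \in gcomp A g ->
    gpr_val (P g a) = talg_pure (mkmalgU g 1 : twisted alpha) a.
  by move=> ag; rewrite /= (aproj_id _ ag) eqxx.
have scalP g (c : F) (a : A) : a \in gcomp A g ->
    gpr_val (twist_base alpha (base_scal A c) * P g a) =
    talg_pure (mkmalgU g c : twisted alpha) a.
  move=> ag; rewrite gpr_valM /= (aproj_id _ ag) eqxx.
  rewrite talg_pureM mul1r /talg_pure -[galg_scal A c * a]/(talg_lact c a).
  rewrite -tpure_act /talg_ract -galg_scalC.
  by rewrite -[_ * _]/(tw_mul alpha (tw_scal alpha c) _) tw_scalU mulr1.
have fI := can_inj fK.
exists T; split=> [g a ag m n|g m a b ag bg|x m|g h a b m ag bh]; apply: fI.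
- by rewrite raddfB !fT raddfB scalerBr.
- rewrite raddfB !fT -scalerBl; congr (_ *: _); apply: val_inj.
  by rewrite [RHS]gpr_valB /= raddfB /talg_pure tpureDr tpureNr.
- rewrite fT !fE scalerA; congr (_ *: _); apply: val_inj.
  rewrite -rmorphM /= (aproj_id _ (base_valP x)) eqxx.
  rewrite -[galg_scal A _ * _]/(talg_lact _ (base_val x)) /talg_pure -tpure_act.
  rewrite /talg_ract mul1r; congr tpure.
  by rewrite -[RHS]/(mkmalgU _ _) mulfV ?Z2_neq0.
- rewrite !fE !fT !scalerA; congr (_ *: _); apply: val_inj.
  rewrite -[RHS]/(gpr_val _) scalP ?gcompM //.
  rewrite [LHS]gpr_valM !PE //.
  rewrite talg_pureM -[X in talg_pure X]/(tw_mul alpha _ _) tw_mulU !mul1r.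
  by [].
Qed.

(** A module over [A] restricts to operators that compose strictly, that is, with
the trivial cocycle as the factor. *)
Lemma restricted_fromP :
  restricted_from M <-> exists T, twisted_action (1%g : Z2 F G) T.
Proof.
split=> [[N [f [[f' fK f'K] fE]]]|[T [TB TA T1 TM]]].
  pose T (g : G) (a : A) m := f' (a *: f m).
  have fT g a m : f (T g a m) = a *: f m by apply: f'K.
  have fI := can_inj fK.
  exists T; split=> [g a ag m n|g m a b ag bg|x m|g h a b m ag bh]; apply: fI;
    rewrite ?base_scal1 ?raddfB ?fT ?raddfB ?scalerBr ?scalerBl ?scalerA ?fE //.
have [||m|g h a b m ag bh|N [f [fbij fE]]] := @graded_action_module F G A M T.
- by move=> g a ag; apply: TB.
- exact: TA.
- by rewrite [LHS](T1 1) base_scal1 scale1r.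
- by rewrite TM // base_scal1.
exists N, f; split=> // x m; rewrite -(fE 1%g) ?base_valP //.
by rewrite T1 base_scal1.
Qed.
End Realizations.

(** * The obstruction map *)

Section InvariantClasses.
Variables (F : fieldType) (G : groupType) (A : gradedAlgebra F G).
Implicit Types (M N : lmodType (base A)).

Lemma abs_simple_brick M : abs_simple M -> brick M.
Proof. by case=> -[? _] ?. Qed.

Lemma Irr_iso (X : Irr A) M N : X M -> X N -> exists f : {linear M -> N}, bijective f.
Proof.
have [M0 _ ->] := Irr_classP X => -[f /linear_inverse[f' [fK f'K]]] [g [g' gK g'K]].
by exists (g \o f'); exists (f \o g') => x /=; rewrite ?gK ?f'K ?fK ?g'K.
Qed.

Lemma Irr_brick (X : Irr A) M : X M -> brick M.
Proof.
have [M0 M0s ->] := Irr_classP X => -[f fbij].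
exact: brick_iso fbij (abs_simple_brick M0s).
Qed.

(** Invariance is known for one module of the class only; the basis is built there
and transported to the others. *)
Lemma Irr_basis (X : Irr_inv A) : exists w : Z2 F G, forall M, X M ->
  exists u : G -> end_r (graded_induced M), twist_basis w u.
Proof.
have [M XM Minv] := Irr_invP X.
have [j jg] := graded_induced_generates M.
have [w [u wu]] := end_r_basis jg (Irr_brick XM) Minv.
exists w => N XN; have [f fbij] := Irr_iso XM XN.
exact: end_r_transport (assoc_graded_iso (induced_iso fbij)) wu.
Qed.
End InvariantClasses.

Theorem theoremA (F : fieldType) (G : groupType) (A : gradedAlgebra F G) :
  exists omega : Irr_inv A -> H2 F G,
    [/\ is_obstruction_map omega,
        forall (X : Irr_inv A) (M : lmodType (base A)), X M ->
          forall alpha : Z2 F G,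
            (cohom_class (alpha^-1)%g = omega X -> restricted_from_twist alpha M) /\
            (strongly_graded A ->
               (restricted_from_twist alpha M <-> cohom_class (alpha^-1)%g = omega X))
      & forall (X : Irr_inv A) (M : lmodType (base A)), X M ->
          (omega X = 1%g -> restricted_from M) /\
          (strongly_graded A -> (restricted_from M <-> omega X = 1%g))].
Proof.
have [w wP] := choice (@Irr_basis F G A).
have obsP (X : Irr_inv A) M : X M -> forall a : Z2 F G,
    cohom_class a = cohom_class (w X) ->
    exists T : G -> A -> M -> M, twisted_action (a^-1)%g T.
  move=> XM a /cohom_classP aw; have [u wu] := wP X M XM.
  have [u' au'] := twist_basis_rescale wu aw.
  have [j jg] := graded_induced_generates M.
  exact: basis_twisted_action jg au'.
have strongP (X : Irr_inv A) M : X M -> strongly_graded A -> forall (a : Z2 F G)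
    (T : G -> A -> M -> M), twisted_action a T ->
    cohom_class (a^-1)%g = cohom_class (w X).
  move=> XM sA a T aT; have [S aS] := obsP X M XM (w X) erefl.
  have /cohomologous_inv := twisted_action_cohom sA (Irr_brick XM) aT aS.
  by rewrite invgK => /cohom_classP.
exists (fun X => cohom_class (w X)); split=> [X M XM a|X M XM alpha|X M XM].
- have [u wu] := wP X M XM; split=> [/cohom_classP aw|/iso_twist_basis[u' au']].
    have [u' au'] := twist_basis_rescale wu aw; exact: twist_basis_iso au'.
  by apply/cohom_classP; apply: twist_basis_cohom au' wu.
- have H : cohom_class (alpha^-1)%g = cohom_class (w X) ->
      restricted_from_twist alpha M.
    move=> /(obsP _ _ XM)[T]; rewrite invgK; exact: twisted_action_restricted.
  split=> // sA; split=> // /restricted_twisted_action[T aT].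
  exact: strongP XM sA _ _ aT.
- have H : cohom_class (w X) = 1%g -> restricted_from M.
    move=> w1; apply/restricted_fromP; rewrite -[1%g]invg1.
    exact: obsP XM _ (esym w1).
  split=> // sA; split=> // /restricted_fromP[T aT].
  by have := strongP X M XM sA _ _ aT; rewrite invg1.
Qed.
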